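(* Let $M$ be a left $\Gamma_{\max}$-matroid. Then $\mathcal{V}(M)=\{X^1\circ\cdots\circ X^k: X^i\in \mathcal{C}(M), k\leq r^*(M)\}$.
   Context: $\Gamma_{\max}$ is the skew hyperfield on $\Gamma\cup\{0\}$ for a totally ordered group $\Gamma$, with multiplication from $\Gamma$ and hyperaddition $x\boxplus y=\{\max\{x,y\}\}$ if $x\neq y$, $x\boxplus x=\{z\le x\}\cup\{0\}$, $0<x$ for $x\in\Gamma$. For $X,Y\in\Gamma_{\max}^E$, $X\circ Y$ is the componentwise maximum; the empty composition ($k=0$) is the zero vector. $\mathcal C(M)$ is the set of circuits of $M$; $\mathcal V(M)$ is the set of vectors, i.e. $V$ with $0\in V_{e_1}Y_{e_1}\boxplus\cdots\boxplus V_{e_n}Y_{e_n}$ for every cocircuit $Y$ of $M$ ($E=\{e_1,\dots,e_n\}$). $r^*(M)$ is the corank of the underlying ordinary matroid. *)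

(* Defs.v *)
From HB Require Import structures.
From mathcomp Require Import all_boot all_order monoid.
From mathcomp Require Import boolp classical_sets.

Set Implicit Arguments.
Unset Strict Implicit.
Unset Printing Implicit Defensive.

Import Order.TTheory.

Local Open Scope classical_set_scope.

(* Totally ordered groups (written multiplicatively, not assumed abelian): the
   order is invariant under translation on both sides. *)
HB.mixin Record isOrderedGroup (d : Order.disp_t) G
    of Group G & Order.Total d G := {
  le_mulg2l : forall x y z : G, (y <= z)%O -> (x * y <= x * z)%O%g;
  le_mulg2r : forall x y z : G, (y <= z)%O -> (y * x <= z * x)%O%g
}.

#[short(type="orderedGroupType")]
HB.structure Definition OrderedGroup (d : Order.disp_t) :=
  {G of isOrderedGroup d G & Group G & Order.Total d G}.

Definition hadd_set (T : Type) (hadd : T -> T -> set T) (A B : set T) : set T :=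
  [set z | exists2 x, A x & exists2 y, B y & hadd x y z].

Record skewHyperfield := SkewHyperfield {
  hf_sort :> choiceType;
  hadd : hf_sort -> hf_sort -> set hf_sort;
  hmul : hf_sort -> hf_sort -> hf_sort;
  hzero : hf_sort;
  hone : hf_sort;
  hopp : hf_sort -> hf_sort;
  hinv : hf_sort -> hf_sort;
  hadd_neq0 : forall x y, hadd x y !=set0;
  haddC : forall x y, hadd x y = hadd y x;
  haddA : forall x y z,
    hadd_set hadd [set x] (hadd y z) = hadd_set hadd (hadd x y) [set z];
  hadd0 : forall x, hadd x hzero = [set x];
  haddN : forall x y, hadd x y hzero <-> y = hopp x;
  hadd_rev : forall x y z, hadd y z x -> hadd x (hopp y) z;
  hmulA : associative hmul;
  hmul1l : left_id hone hmul;
  hmul1r : right_id hone hmul;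
  hone_neq0 : hone != hzero;
  hmulVl : forall x, x != hzero -> hmul (hinv x) x = hone;
  hmulVr : forall x, x != hzero -> hmul x (hinv x) = hone;
  hmul0l : left_zero hzero hmul;
  hmul0r : right_zero hzero hmul;
  hmulDl : forall a x y, hmul a @` hadd x y = hadd (hmul a x) (hmul a y);
  hmulDr : forall a x y, hmul^~ a @` hadd x y = hadd (hmul x a) (hmul y a)
}.

(* Ordinary matroids on E, given by their set N of circuits. *)
Section Matroid.
Variables (E : finType) (N : {set {set E}}).

Definition mindep (A : {set E}) : bool := [forall S in N, ~~ (S \subset A)].

Definition mbasis (B : {set E}) : bool := maxset mindep B.

(* The bases of the dual matroid are the complements of the bases. *)
Definition mcoindep (A : {set E}) : bool :=
  [exists B, mbasis B && (A \subset ~: B)%SET].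

Definition mcocircuits : {set {set E}} :=
  finset (fun K : {set E} => minset (fun A => ~~ mcoindep A) K).

Definition mcorank : nat := \max_(A : {set E} | mcoindep A) #|A|.

Definition modular_pair (S T : {set E}) : bool :=
  (S != T) &&
  [forall S' in N, forall T' in N,
     (S' != T') ==> ~~ ((S' :|: T')%SET \proper (S :|: T)%SET)].

End Matroid.

Section HMatroid.
Variables (H : skewHyperfield) (E : finType).

Notation vec := {ffun E -> H}.

Definition vzero : vec := [ffun=> hzero H].

Definition lscale (a : H) (X : vec) : vec := [ffun e => hmul a (X e)].
Definition rscale (a : H) (X : vec) : vec := [ffun e => hmul (X e) a].

Definition supp (X : vec) : {set E} := finset (fun e => X e != hzero H).

Definition supports (C : set vec) : {set {set E}} :=
  finset (fun S : {set E} => `[< exists2 X, C X & supp X = S >]).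

(* [scale] is [lscale] for left and [rscale] for right H-matroids.  These are
   weak H-matroids: elimination is only required of modular pairs. *)
Definition circuit_axioms (scale : H -> vec -> vec) (C : set vec) : Prop :=
  [/\ ~ C vzero,
      forall a X, a != hzero H -> C X -> C (scale a X),
      forall X Y, C X -> C Y -> supp X \subset supp Y ->
        exists2 a, a != hzero H & Y = scale a X
    & forall X Y e, C X -> C Y ->
        modular_pair (supports C) (supp X) (supp Y) ->
        X e = hopp (Y e) -> X e != hzero H ->
        exists Z, [/\ C Z, Z e = hzero H & forall f, hadd (X f) (Y f) (Z f)]].

Record leftMatroid := LeftMatroid {
  circuits : set vec;
  circuitsP : circuit_axioms lscale circuits
}.

Record rightMatroid := RightMatroid {
  rcircuits : set vec;
  rcircuitsP : circuit_axioms rscale rcircuits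
}.

Definition orthogonal (X Y : vec) : Prop :=
  (\big[hadd_set (@hadd H)/[set hzero H]]_(e : E) [set hmul (X e) (Y e)])
    (hzero H).

(* The dual of M is the unique right H-matroid on the dual of the underlying
   matroid whose circuits are orthogonal to each circuit of M that they meet in
   at most 3 elements. *)
Definition is_dual (M : leftMatroid) (M' : rightMatroid) : Prop :=
  supports (rcircuits M') = mcocircuits (supports (circuits M)) /\
  forall X Y, circuits M X -> rcircuits M' Y ->
    (#|(supp X :&: supp Y)%SET| <= 3)%N -> orthogonal X Y.

Definition cocircuits (M : leftMatroid) : set vec :=
  [set Y | exists2 M', is_dual M M' & rcircuits M' Y].

Definition vectors (M : leftMatroid) : set vec :=
  [set V | forall Y, cocircuits M Y -> orthogonal V Y].

Definition corank (M : leftMatroid) : nat := mcorank (supports (circuits M)).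

End HMatroid.

(* [None] is the zero of Gamma_max, below all elements of Gamma. *)
Section GammaMax.
Variables (d : Order.disp_t) (Gamma : orderedGroupType d).

Notation G0 := (option Gamma).

Definition gle (x y : G0) : bool :=
  match x, y with
  | None, _ => true
  | Some _, None => false
  | Some a, Some b => (a <= b)%O
  end.

Definition gmax (x y : G0) : G0 := if gle x y then y else x.

Definition gadd (x y : G0) : set G0 :=
  if x == y then [set z | gle z x] else [set gmax x y].

Definition gmul (x y : G0) : G0 :=
  match x, y with
  | Some a, Some b => Some (a * b)%g
  | _, _ => None
  end.

Definition ginv (x : G0) : G0 := omap (fun a => a^-1)%g x.

Lemma glexx x : gle x x.
Proof. by case: x => //= a. Qed.

Lemma gle_trans y x z : gle x y -> gle y z -> gle x z.
Proof. by case: x y z => [a|] [b|] [c|] //=; exact: le_trans. Qed.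

Lemma gle_anti x y : gle x y -> gle y x -> x = y.
Proof.
by case: x y => [a|] [b|] //= h1 h2; congr Some; apply/le_anti/andP.
Qed.

Lemma gle_total x y : gle x y || gle y x.
Proof. by case: x y => [a|] [b|] //=; exact: le_total. Qed.

(* z lies in x [+] y iff the maximum of x, y, z is attained at least twice. *)
Lemma gaddP x y z : gadd x y z <->
  [\/ x = y /\ gle z x, x = z /\ gle y x | y = z /\ gle x y].
Proof.
rewrite /gadd /gmax; case: eqP => [<-|ne] /=; split.
- by move=> ?; constructor 1.
- by case=> -[] // <- _; exact: glexx.
- case: ifP => h ->; first by constructor 3.
  by constructor 2; split=> //; move: (gle_total x y); rewrite h.
- case=> -[] // e h; last by rewrite h.
  by rewrite -e; case: ifP => // h'; case: ne; exact: gle_anti.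
Qed.

Lemma gaddC x y : gadd x y = gadd y x.
Proof.
apply/seteqP; split=> z /gaddP h; apply/gaddP; case: h => -[e h].
- by constructor 1; rewrite -e.
- by constructor 3.
- by constructor 2.
- by constructor 1; rewrite -e.
- by constructor 3.
- by constructor 2.
Qed.

Lemma gadd_neq0 x y : gadd x y !=set0.
Proof.
exists (gmax x y); apply/gaddP; rewrite /gmax; case: ifP => h.
  by constructor 3.
by constructor 2; split=> //; move: (gle_total x y); rewrite h.
Qed.

Lemma gaddA_sub x y z :
  hadd_set gadd [set x] (gadd y z) `<=` hadd_set gadd (gadd x y) [set z].
Proof.
move=> t [_ /= -> [w /gaddP hw /gaddP ht]].
suff [u hu ht'] : exists2 u, gadd x y u & gadd u z t.
  by exists u => //; exists z.
have tot a b : gle a b \/ gle b a by apply/orP/gle_total.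
case: hw ht => [[<- h1]|[<- h1]|[<- h1]].
- case=> [[-> h2]|[<- h2]|[<- h2]].
  + exists y; apply/gaddP; first by constructor 3.
    by constructor 1; split=> //; exact: gle_trans h2 h1.
  + case: (tot x y) => h3.
      by exists y; apply/gaddP; [constructor 3 | constructor 1].
    by exists x; apply/gaddP; constructor 2.
  + exists y; apply/gaddP; last by constructor 1.
    by constructor 3; split=> //; exact: gle_trans h2 h1.
- case=> [[-> h2]|[<- h2]|[<- h2]].
  + case: (tot z t) => h3.
      by exists t; apply/gaddP; [constructor 1 | constructor 2].
    by exists z; apply/gaddP; constructor 1.
  + exists x; apply/gaddP; first by constructor 2.
    by constructor 2; split=> //; exact: gle_trans h1 h2.
  + by exists y; apply/gaddP; [constructor 3 | constructor 2].
- case=> [[-> h2]|[<- h2]|[<- h2]].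
  + by exists z; apply/gaddP; [constructor 2 | constructor 1].
  + exists x; apply/gaddP; last by constructor 2.
    by constructor 2; split=> //; exact: gle_trans h1 h2.
  + case: (tot x y) => h3.
      by exists y; apply/gaddP; constructor 3.
    by exists x; apply/gaddP; [constructor 2 | constructor 3].
Qed.

Lemma gaddA x y z :
  hadd_set gadd [set x] (gadd y z) = hadd_set gadd (gadd x y) [set z].
Proof.
apply/seteqP; split; first exact: gaddA_sub.
move=> t [w hw [_ /= -> ht]].
have /gaddA_sub [u hu [_ /= -> ht']] :
    hadd_set gadd [set z] (gadd y x) t.
  by exists z => //; exists w; rewrite gaddC.
by exists x => //; exists u; rewrite gaddC.
Qed.

Lemma gadd0 x : gadd x None = [set x].
Proof.
apply/seteqP; split=> z /=.
  by case/gaddP => -[]; case: x z => [a|] [b|].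
by move=> ->; apply/gaddP; constructor 2; case: x.
Qed.

Lemma gaddN x y : gadd x y None <-> y = x.
Proof.
split; first by case/gaddP => -[]; case: x y => [a|] [b|].
by move=> ->; apply/gaddP; constructor 1; case: x.
Qed.

Lemma gadd_rev x y z : gadd y z x -> gadd x y z.
Proof.
move=> /gaddP h; apply/gaddP; case: h => -[e h].
- by constructor 3; rewrite -?e.
- by constructor 1; rewrite -?e.
- by constructor 2; rewrite -?e.
Qed.

Lemma gmulA : associative gmul.
Proof. by move=> [a|] [b|] [c|] //=; rewrite mulgA. Qed.

Lemma gmul1l : left_id (Some 1%g) gmul.
Proof. by case=> [a|] //=; rewrite mul1g. Qed.

Lemma gmul1r : right_id (Some 1%g) gmul.
Proof. by case=> [a|] //=; rewrite mulg1. Qed.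

Lemma gmulVl x : x != None -> gmul (ginv x) x = Some 1%g.
Proof. by case: x => [a|] //= _; rewrite mulVg. Qed.

Lemma gmulVr x : x != None -> gmul x (ginv x) = Some 1%g.
Proof. by case: x => [a|] //= _; rewrite mulgV. Qed.

Lemma gmul0l : left_zero None gmul.
Proof. by []. Qed.

Lemma gmul0r : right_zero None gmul.
Proof. by case. Qed.

Lemma gle_mul2l a x y : gle x y -> gle (gmul a x) (gmul a y).
Proof. by case: a x y => [a|] [x|] [y|] //=; exact: le_mulg2l. Qed.

Lemma gle_mul2r a x y : gle x y -> gle (gmul x a) (gmul y a).
Proof. by case: a x y => [a|] [x|] [y|] //=; exact: le_mulg2r. Qed.

Lemma gadd_img (f g : G0 -> G0) x y : cancel f g -> cancel g f ->
  {homo f : u v / gle u v} -> {homo g : u v / gle u v} ->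
  f @` gadd x y = gadd (f x) (f y).
Proof.
move=> fK gK fle gle'; apply/seteqP; split=> z.
  case=> w /gaddP h <-; apply/gaddP; case: h => -[<- h].
  - by constructor 1; split=> //; exact: fle.
  - by constructor 2; split=> //; exact: fle.
  - by constructor 3; split=> //; exact: fle.
move=> /gaddP h; exists (g z) => //; apply/gaddP; case: h => -[e h].
- by constructor 1; rewrite (can_inj fK e) -[y]fK; split=> //;
    rewrite -e; exact: gle'.
- by constructor 2; rewrite -e fK; split=> //;
    rewrite -[x]fK -[y]fK; exact: gle'.
- by constructor 3; rewrite -e fK; split=> //;
    rewrite -[x]fK -[y]fK; exact: gle'.
Qed.

Lemma gadd_img0 x y : (fun=> None) @` gadd x y = gadd None None.
Proof.
rewrite gadd0; apply/seteqP; split=> z; first by case=> w _ <-.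
by move=> ->; have [w hw] := gadd_neq0 x y; exists w.
Qed.

Lemma gmulDl a x y : gmul a @` gadd x y = gadd (gmul a x) (gmul a y).
Proof.
case: (eqVneq a None) => [->|a0]; first exact: gadd_img0.
apply: (@gadd_img _ (gmul (ginv a))) => [z|z|u v|u v].
- by rewrite gmulA gmulVl // gmul1l.
- by rewrite gmulA gmulVr // gmul1l.
- exact: gle_mul2l.
- exact: gle_mul2l.
Qed.

Lemma gmulDr a x y : gmul^~ a @` gadd x y = gadd (gmul x a) (gmul y a).
Proof.
case: (eqVneq a None) => [->|a0].
  rewrite !gmul0r -(gadd_img0 x y); apply/seteqP.
  by split=> z [w hw <-]; exists w; rewrite ?gmul0r.
apply: (@gadd_img (gmul^~ a) (gmul^~ (ginv a))) => [z|z|u v|u v].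
- by rewrite -gmulA gmulVr // gmul1r.
- by rewrite -gmulA gmulVl // gmul1r.
- exact: gle_mul2r.
- exact: gle_mul2r.
Qed.

Definition GammaMax : skewHyperfield :=
  @SkewHyperfield G0 gadd gmul None (Some 1%g) id ginv
    gadd_neq0 gaddC gaddA gadd0 gaddN gadd_rev
    gmulA gmul1l gmul1r isT gmulVl gmulVr gmul0l gmul0r gmulDl gmulDr.

Definition vcomp (E : finType) (X Y : {ffun E -> GammaMax}) :
    {ffun E -> GammaMax} :=
  [ffun e => gmax (X e) (Y e)].

End GammaMax.

(* Main.v *)
(* Over Gamma_max, [X] and [Y] are orthogonal iff the maximum of the nonzero
   products [X e * Y e], if any, is attained at least twice.
   A basis [B] of [supp V] can be chosen "tight": scaled to agree
   with [V] at [e], the fundamental circuit of each [e] outside [B] is below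
   [V]; such a [B] is built one element at a time, exchanging along the new
   circuit where it is tight.  If [V] is a vector, orthogonality to the
   fundamental cocircuit of [b] in [B] forces some fundamental circuit to agree
   with [V] at [b], so [V] is the maximum of these circuits, whose number is the
   nullity of [supp V].
   Cocircuits exist because the ratio [X f : X g] does not depend on the circuit
   [X] meeting a given cocircuit of the underlying matroid exactly in [{f, g}].
   Orthogonality to circuits with larger intersections follows by induction on
   the intersection: at a unique maximum [e], eliminating with a suitable
   modular circuit removes another common element and keeps [e] maximal. *)
Require Import Defs.
From mathcomp Require Import all_boot all_order monoid.
From mathcomp Require Import boolp classical_sets.
From mathcomp Require Import fintype finset.

Set Implicit Arguments.
Unset Strict Implicit.
Unset Printing Implicit Defensive.

(** * Ordinary matroids given by circuits *)

Section CircuitMatroid.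
Variables (E : finType) (N : {set {set E}}).
Implicit Types (A B K S T U Z : {set E}) (e f g x y z : E).

Hypothesis circuit_antichain : forall S T, S \in N -> T \in N -> S \subset T ->
  S = T.

Lemma mindepP A : reflect (forall S, S \in N -> ~ S \subset A) (mindep N A).
Proof.
apply: (iffP forall_inP) => h S SN; first exact/negP/h.
exact/negP/h.
Qed.

Lemma dependentP A : reflect (exists2 S, S \in N & S \subset A) (~~ mindep N A).
Proof.
rewrite /mindep negb_forall_in.
by apply: (iffP exists_inP) => -[S SN h]; exists S => //; move: h; rewrite negbK.
Qed.

Hypothesis circuit_elim : forall S T e, S \in N -> T \in N -> S != T ->
  e \in S -> e \in T -> exists2 Z, Z \in N & Z \subset (S :|: T) :\ e.

(** Induction on the size of the union. If weak elimination loses [f], its result [Z1] contains some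
    [g] of [T] outside [S]. Eliminating [g] from [T] and [Z1] while keeping [e] gives [Z2]; then [e]
    is eliminated from [S] and [Z2]. The first union misses [f] and the second misses [g], so both
    are smaller. *)
Lemma strong_elim S T e f : S \in N -> T \in N -> e \in S -> e \in T ->
  f \in S -> f \notin T ->
  exists2 Z, Z \in N & (f \in Z) && (Z \subset (S :|: T) :\ e).
Proof.
move: {2}(#|S :|: T|).+1 (ltnSn #|S :|: T|) => n.
elim: n S T e f => // n IHn S T e f; rewrite ltnS => le_n SN TN eS eT fS fT.
have neST : S != T by apply: contraNneq fT => <-.
have [Z1 Z1N sZ1] := circuit_elim SN TN neST eS eT.
have [fZ1|fZ1] := boolP (f \in Z1); first by exists Z1; rewrite ?fZ1.
have in1 x : x \in Z1 -> (x != e) && ((x \in S) || (x \in T)).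
  by move/(subsetP sZ1); rewrite !inE.
have [g gZ1 gS] : exists2 g, g \in Z1 & g \notin S.
  apply/subsetPn; apply: contraNN fZ1 => sZS.
  by rewrite (circuit_antichain Z1N SN sZS).
have gT : g \in T by have := in1 _ gZ1; rewrite (negPf gS) => /andP[].
have eZ1 : e \notin Z1 by apply/negP => /in1; rewrite eqxx.
have [|Z2 Z2N /andP[eZ2 sZ2]] := IHn T Z1 g e _ TN Z1N gT gZ1 eT eZ1.
  apply: leq_trans le_n; apply: proper_card; apply/properP; split.
    apply/subsetP => x; rewrite !inE => /orP[->|/in1/andP[]//]; exact: orbT.
  by exists f; rewrite !inE ?fS // (negPf fT).
have in2 x : x \in Z2 -> (x != g) && ((x \in T) || (x \in Z1)).
  by move/(subsetP sZ2); rewrite !inE.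
have fZ2 : f \notin Z2 by apply/negP => /in2; rewrite (negPf fT) (negPf fZ1) andbF.
have [|Z3 Z3N /andP[fZ3 sZ3]] := IHn S Z2 e f _ SN Z2N eS eZ2 fS fZ2.
  apply: leq_trans le_n; apply: proper_card; apply/properP; split.
    apply/subsetP => x; rewrite !inE =>
      /orP[->//|/in2/andP[_ /orP[->|/in1/andP[]//]]].
    exact: orbT.
  exists g; rewrite !inE ?gT ?orbT // (negPf gS) /=.
  by apply/negP => /in2; rewrite eqxx.
exists Z3 => //; rewrite fZ3; apply/subsetP => x /(subsetP sZ3); rewrite !inE.
case/andP => -> /orP[->//|/in2/andP[_ /orP[->|/in1/andP[]//]]]; exact: orbT.
Qed.

(** * Closure in terms of circuits *)

Definition spans A z : Prop :=
  z \in A \/ exists2 S, S \in N & (z \in S) && (S \subset z |: A).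

(** Induction on the number of elements of the circuit through [z] outside [z |: A]. Such an element
    [w] lies on a circuit inside [w |: A]; strong elimination of [w] keeps [z] and brings in
    elements of [A] only. *)
Lemma spans_trans A B z :
  spans B z -> (forall w, w \in B -> spans A w) -> spans A z.
Proof.
have [zA|zA] := boolP (z \in A); first by left.
move=> [zB|[S SN /andP[zS sSB]]] hB; first exact: hB.
have {B sSB hB}: forall w, w \in S -> w = z \/ spans A w.
  by move=> w /(subsetP sSB); rewrite in_setU1 => /orP[/eqP|/hB]; [left|right].
move: {2}(#|S :\: (z |: A)|).+1 (ltnSn #|S :\: (z |: A)|) => n.
elim: n S SN zS => // n IHn S SN zS; rewrite ltnS => le_n hS.
have [sS|/subsetPn[w wS]] := boolP (S \subset z |: A).
  by right; exists S; rewrite ?zS.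
rewrite !inE negb_or => /andP[wz wA].
case: (hS w wS) => [/eqP|]; first by rewrite (negPf wz).
case=> [|[T TN /andP[wT sT]]]; first by rewrite (negPf wA).
have zT : z \notin T.
  by apply/negP => /(subsetP sT); rewrite !inE eq_sym (negPf wz) (negPf zA).
have [Z ZN /andP[zZ sZ]] := strong_elim SN TN wS wT zS zT.
have inZ x : x \in Z -> (x != w) && ((x \in S) || (x \in A)).
  move/(subsetP sZ); rewrite !inE => /andP[xw /orP[->|/(subsetP sT)]].
    by rewrite xw.
  by rewrite !inE (negPf xw) /= => ->; rewrite orbT.
apply: (IHn Z) => //.
  apply: leq_trans le_n; apply: proper_card; apply/properP; split.
    apply/subsetP => x; rewrite !inE !negb_or => /andP[/andP[-> xA] /inZ/andP[_]].
    by rewrite (negPf xA) orbF.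
  by exists w; rewrite !inE ?negb_or ?wz ?wA //=; apply/negP => /inZ; rewrite eqxx.
move=> x /inZ/andP[_ /orP[/hS //|xA]]; by right; left.
Qed.

Lemma mindep_sub A B : A \subset B -> mindep N B -> mindep N A.
Proof.
move=> sAB /mindepP h; apply/mindepP => S SN sS.
by apply: (h S SN); apply: subset_trans sAB.
Qed.

Lemma mindepU1 A z : mindep N A -> ~ spans A z -> mindep N (z |: A).
Proof.
move=> iA nz; apply/mindepP => S SN sS; apply: nz; right; exists S => //.
rewrite sS andbT; apply/negPn/negP => zS; move/mindepP: iA => /(_ S SN); apply.
apply/subsetP => x xS; move/(subsetP sS): (xS); rewrite !inE => /orP[/eqP xz|//].
by rewrite -xz xS in zS.
Qed.

Lemma mindep_notspan A x : mindep N A -> x \in A -> ~ spans (A :\ x) x.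
Proof.
move=> /mindepP iA xA [|[S SN /andP[_ sS]]]; first by rewrite !inE eqxx.
by apply: (iA S SN); apply: subset_trans sS _; rewrite setD1K.
Qed.

(** * Bases, fundamental circuits and exchange *)

Lemma mbasisP B : mbasis N B <-> mindep N B /\ forall z, spans B z.
Proof.
split=> [/maxsetP[iB mB]|[iB sB]].
  split=> // z; have [zB|zB] := boolP (z \in B); first by left.
  right; have : ~~ mindep N (z |: B).
    apply/negP => h; have := mB _ h (subsetUr _ _) => e.
    by rewrite -e !inE eqxx in zB.
  case/dependentP => S SN sS; exists S; rewrite // sS andbT.
  apply/negPn/negP => zS; move/mindepP: iB => /(_ S SN); apply.
  apply/subsetP => x xS; move/(subsetP sS): (xS); rewrite !inE => /orP[/eqP xz|//].
  by rewrite -xz xS in zS.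
apply/maxsetP; split=> // A iA sBA; apply/eqP; rewrite eqEsubset sBA andbT.
apply/subsetP => z zA; have [//|[S SN /andP[zS sS]]] := sB z.
case: (mindepP A iA S SN); apply: (subset_trans sS).
by apply/subsetP => x; rewrite !inE => /orP[/eqP->//|/(subsetP sBA)].
Qed.

Lemma mbasis_indep B : mbasis N B -> mindep N B.
Proof. by case/mbasisP. Qed.

Lemma mbasis_sub B B' : mbasis N B -> mbasis N B' -> B \subset B' -> B' = B.
Proof. by move=> /maxsetP[_ mB] /mbasis_indep iB'; exact: mB. Qed.

Lemma fund_circuit B z : mbasis N B -> z \notin B ->
  exists2 S, S \in N & (z \in S) && (S \subset z |: B).
Proof. by move=> /mbasisP[_ /(_ z)[->|]]. Qed.

Lemma max_indep A I : mindep N I -> I \subset A ->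
  exists J, [/\ mindep N J, I \subset J, J \subset A & forall z, z \in A ->
    spans J z].
Proof.
move=> iI sIA.
have [|J /maxsetP[/andP[iJ sJA] mJ] sIJ] :=
  @maxset_exists _ (fun J => mindep N J && (J \subset A)) I.
  by rewrite iI.
exists J; split=> // z zA; apply: contrapT => nz.
have := mJ (z |: J); rewrite mindepU1 // subUset sub1set zA sJA subsetUr.
by move=> /(_ isT isT) eJ; apply: nz; left; rewrite -eJ !inE eqxx.
Qed.

Lemma basis_extend I B0 : mindep N I -> mbasis N B0 ->
  exists B, [/\ mbasis N B, I \subset B & B \subset I :|: B0].
Proof.
move=> iI /mbasisP[_ s0].
have [J [iJ sIJ sJ hJ]] := max_indep iI (subsetUl I B0).
exists J; split=> //; apply/mbasisP; split=> // z.
by apply: (spans_trans (s0 z)) => w wB; apply: hJ; rewrite inE wB orbT.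
Qed.

(** Both circuits pass through [z] because [A] is independent; if they differed, eliminating [z]
    would leave a circuit inside [A]. *)
Lemma fund_circuit_uniq A z S T : mindep N A -> S \in N -> T \in N ->
  S \subset z |: A -> T \subset z |: A -> S = T.
Proof.
move=> /mindepP iA SN TN sS sT; apply/eqP/negPn/negP => neST.
have key U : U \in N -> U \subset z |: A -> z \in U.
  move=> UN sU; apply/negPn/negP => zU; apply: (iA U UN).
  apply/subsetP => x xU; move/(subsetP sU): (xU); rewrite !inE => /orP[/eqP xz|//].
  by rewrite -xz xU in zU.
have [Z ZN sZ] := circuit_elim SN TN neST (key _ SN sS) (key _ TN sT).
apply: (iA Z ZN); apply: subset_trans sZ _; rewrite subDset.
by rewrite subUset sS sT.
Qed.

(** [S] is the only circuit inside [y |: B], and removing [x] destroys it. *)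
Lemma indep_swap B x y S : mindep N B -> y \notin B -> S \in N ->
  S \subset y |: B -> x \in S -> x \in B -> mindep N (y |: (B :\ x)).
Proof.
move=> iB yB SN sS xS xB.
have neq : x != y by apply: contraNneq yB => <-.
apply: mindepU1; first exact: mindep_sub (subD1set _ _) iB.
case=> [|[T TN /andP[yT sT]]]; first by rewrite !inE (negPf yB) andbF.
have sTB : T \subset y |: B by apply: subset_trans sT _; rewrite setUS // subD1set.
have eT := fund_circuit_uniq iB TN SN sTB sS.
by have := subsetP sT x; rewrite eT xS !inE (negPf neq) eqxx => /(_ isT).
Qed.

Lemma basis_swap B x y S : mbasis N B -> y \notin B -> S \in N ->
  S \subset y |: B -> x \in S -> x \in B -> mbasis N (y |: (B :\ x)).
Proof.
move=> bB yB SN sS xS xB; have [iB sB] := (mbasisP B).1 bB.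
apply/mbasisP; split; first exact: indep_swap SN sS xS xB.
move=> z; apply: (spans_trans (sB z)) => w wB.
have [->|wx] := eqVneq w x; last by left; rewrite !inE wx wB orbT.
right; exists S; rewrite // xS; apply/subsetP => v /(subsetP sS).
by rewrite !inE; case: (v == x) => //=.
Qed.

(** If no exchange were possible, the fundamental circuits of the elements of [B'] outside [B] would
    all avoid [x], so [B :\ x] would span [B'] and hence [x]. *)
Lemma basis_exchange B B' x : mbasis N B -> mbasis N B' -> x \in B -> x \notin B' ->
  exists2 y, (y \in B') && (y \notin B) & mbasis N (y |: (B :\ x)).
Proof.
move=> bB bB' xB xB'; have [iB sB] := (mbasisP B).1 bB.
apply: contrapT => no; apply: (mindep_notspan iB xB).
have [_ sB'] := (mbasisP B').1 bB'.
apply: (spans_trans (sB' x)) => w wB'.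
have wx : w != x by apply: contraNneq xB' => <-.
have [wB|wB] := boolP (w \in B); first by left; rewrite !inE wx.
have [S SN /andP[wS sS]] := fund_circuit bB wB.
right; exists S; rewrite // wS; apply/subsetP => v vS.
move/(subsetP sS): (vS); rewrite !inE => /orP[->//|vB]; rewrite vB andbT.
apply/orP; right; apply/eqP => vx; apply: no; exists w; first by rewrite wB'.
by apply: (basis_swap bB wB SN sS) => //; rewrite -vx.
Qed.

(** Adding two elements to [B] gives nullity at most two. If two circuits there had a smaller union,
    missing [x], then eliminating [y] where necessary would produce one circuit in [z |: B] avoiding
    [x] and another through [x], against uniqueness. *)
Lemma basis_modular B y z S T : mindep N B -> S \in N -> T \in N -> S != T ->
  S \subset y |: (z |: B) -> T \subset y |: (z |: B) -> modular_pair N S T.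
Proof.
move=> iB SN TN neST sS sT; rewrite /modular_pair neST /=.
apply/forall_inP => S' S'N; apply/forall_inP => T' T'N; apply/implyP => ne'.
apply/negP => /properP[sub [x xST xST']].
have [R [RN sR xR]] : exists R, [/\ R \in N, R \subset y |: (z |: B) & x \in R].
  by move: xST; rewrite inE => /orP[] h; [exists S|exists T].
have sST : S :|: T \subset y |: (z |: B) by rewrite subUset sS.
move: xST'; rewrite inE negb_or => /andP[xS' xT'].
have sS' : S' \subset y |: (z |: B).
  by apply: subset_trans sST; apply: subset_trans sub; apply: subsetUl.
have sT' : T' \subset y |: (z |: B).
  by apply: subset_trans sST; apply: subset_trans sub; apply: subsetUr.
have drop U : y \notin U -> U \subset y |: (z |: B) -> U \subset z |: B.
  move=> yU sU; apply/subsetP => v vU; move/(subsetP sU): (vU).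
  by rewrite in_setU1 => /orP[/eqP vy|//]; rewrite -vy vU in yU.
wlog yS' : S' T' S'N T'N ne' {sub} xS' xT' sS' sT' / y \in S'.
  move=> hw; have [yS'|yS'] := boolP (y \in S'); first exact: (hw S' T').
  have [yT'|yT'] := boolP (y \in T'); first by apply: (hw T' S') => //;
    rewrite eq_sym.
  move: ne'; rewrite (@fund_circuit_uniq B z S' T') ?eqxx //; exact: drop.
have [Z [ZN sZ xZ]] : exists Z, [/\ Z \in N, Z \subset z |: B & x \notin Z].
  have [yT'|yT'] := boolP (y \in T'); last by exists T'; split=> //; apply: drop.
  have [Z ZN sZ] := circuit_elim S'N T'N ne' yS' yT'.
  exists Z; split=> //.
    apply: subset_trans sZ _; rewrite subDset subUset sS' sT' //.
  by apply/negP => /(subsetP sZ); rewrite !inE (negPf xS') (negPf xT') andbF.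
have [W [WN sW xW]] : exists Z, [/\ Z \in N, Z \subset z |: B & x \in Z].
  have [yR|yR] := boolP (y \in R); last by exists R; split=> //; apply: drop.
  have [W WN /andP[xW sW]] := strong_elim RN S'N yR yS' xR xS'.
  by exists W; split=> //; apply: subset_trans sW _; rewrite subDset subUset sR sS'.
by move: xZ; rewrite (fund_circuit_uniq iB ZN WN sZ sW) xW.
Qed.

(** * Cocircuits and modular pairs *)

Lemma not_coindepP A : reflect (forall B, mbasis N B -> exists2 x,
  x \in B & x \in A)
  (~~ mcoindep N A).
Proof.
rewrite /mcoindep negb_exists; apply: (iffP forallP) => h B.
  move=> bB; have := h B; rewrite bB /= => /subsetPn[x xA].
  by rewrite inE negbK => xB; exists x.
rewrite negb_and -implybE; apply/implyP => /h[x xB xA].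
by apply/subsetPn; exists x; rewrite // inE xB.
Qed.

Lemma cocircuitP K : K \in mcocircuits N <-> 
  (forall B, mbasis N B -> exists2 x, x \in B & x \in K) /\
  (forall A, (forall B, mbasis N B -> exists2 x, x \in B & x \in A) ->
     A \subset K -> A = K).
Proof.
rewrite inE; split=> [/minsetP[/not_coindepP h m]|[/not_coindepP h m]].
  by split=> // A /not_coindepP; exact: m.
by apply/minsetP; split=> // A /not_coindepP; exact: m.
Qed.

Lemma cocircuit_antichain K K' : K \in mcocircuits N -> K' \in mcocircuits N ->
  K \subset K' -> K = K'.
Proof. by move=> /cocircuitP[h _] /cocircuitP[_]; apply. Qed.

(** By minimality of [K] some basis misses [K :\ b]; it still meets [K], so it does so in [b]
    alone. *)
Lemma cocircuit_basis K b : K \in mcocircuits N -> b \in K ->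
  exists2 B, mbasis N B & B :&: K = [set b].
Proof.
move=> /cocircuitP[hK mK] bK; apply: contrapT => no.
suff /mK/(_ (subD1set _ _)) e :
    forall B, mbasis N B -> exists2 x, x \in B & x \in K :\ b.
  by move: bK; rewrite -e !inE eqxx.
move=> B bB; apply: contrapT => no'; apply: no; exists B => //.
have [x xB xK] := hK B bB.
have only v : v \in B -> v \in K -> v = b.
  move=> vB vK; apply/eqP/negPn/negP => vb; apply: no'; exists v => //.
  by rewrite !inE vb.
apply/setP => v; rewrite !inE; apply/andP/eqP => [[vB vK]|->]; first exact: only.
by rewrite -(only x xB xK).
Qed.

(** A basis avoiding the complement of [B :\ b] would lie strictly inside [B]. That complement
    therefore meets every basis, and a minimal subset of it with this property is the required
    cocircuit. *)
Lemma fund_cocircuit B b : mbasis N B -> b \in B ->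
  exists2 K, K \in mcocircuits N & B :&: K = [set b].
Proof.
move=> bB hb.
have h : ~~ mcoindep N (~: (B :\ b)).
  apply/not_coindepP => B' bB'; apply: contrapT => no.
  have sB' : B' \subset B :\ b.
    apply/subsetP => x xB'; apply/negPn/negP => xn; apply: no; exists x => //.
    by rewrite inE.
  have e := mbasis_sub bB' bB (subset_trans sB' (subD1set _ _)).
  by move: sB'; rewrite -e => /subsetP/(_ b hb); rewrite !inE eqxx.
have [K mK sK] := @minset_exists _ (fun A => ~~ mcoindep N A) _ h.
exists K; first by rewrite inE.
have only v : v \in B -> v \in K -> v = b.
  move=> vB /(subsetP sK); rewrite !inE vB andbT negbK; exact: eqP.
have /minsetP[/not_coindepP/(_ B bB)[x xB xK] _] := mK.
apply/setP => v; rewrite !inE; apply/andP/eqP => [[vB vK]|->]; first exact: only.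
by rewrite -(only x xB xK).
Qed.

Lemma basis_extend_co I K b : K \in mcocircuits N -> b \in K -> mindep N I ->
  (forall x, x \in I -> x \in K -> x = b) ->
  exists B, [/\ mbasis N B, I \subset B & B :&: K = [set b]].
Proof.
move=> KN bK iI hI; have [B0 b0 e0] := cocircuit_basis KN bK.
have [B [bB sIB sB]] := basis_extend iI b0; exists B; split=> //.
have only v : v \in B -> v \in K -> v = b.
  move=> /(subsetP sB); rewrite inE => /orP[|vB vK]; first exact: hI.
  by apply/set1P; rewrite -e0 inE vB.
have [/(_ B bB)[x xB xK] _] := (cocircuitP K).1 KN.
apply/setP => v; rewrite !inE; apply/andP/eqP => [[vB vK]|->]; first exact: only.
by rewrite -(only x xB xK).
Qed.

Lemma circuit_indep S e : S \in N -> e \in S -> mindep N (S :\ e).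
Proof.
move=> SN eS; apply/mindepP => T TN sT.
have e' := circuit_antichain TN SN (subset_trans sT (subD1set _ _)).
by move/subsetP: sT => /(_ e); rewrite e' !inE eqxx eS => /(_ isT).
Qed.

(** Were [e] the only common element, [S :\ e] would extend to a basis meeting [K] in [e] alone, and
    this basis would contain [S]. *)
Lemma circuit_cocircuit S K e : S \in N -> K \in mcocircuits N -> e \in S ->
  e \in K ->
  exists2 f, f != e & (f \in S) && (f \in K).
Proof.
move=> SN KN eS eK; apply: contrapT => no.
have [|B [bB sB eB]] := basis_extend_co KN eK (circuit_indep SN eS).
  move=> x; rewrite !inE => /andP[xe xS] xK.
  by case: no; exists x; rewrite ?xS.
case: (mindepP _ (mbasis_indep bB) S SN); apply/subsetP => x xS.
have [->|xe] := eqVneq x e; last by apply: (subsetP sB); rewrite !inE xe.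
by have /setIP[] : e \in B :&: K by rewrite eB inE.
Qed.

(** The fundamental circuit of [f] must meet [K] a second time, and [b] is the only element of [B]
    available. *)
Lemma fund_circuit_co B K b f : mbasis N B -> K \in mcocircuits N ->
  B :&: K = [set b] -> f \in K -> f != b ->
  exists2 S, S \in N & [/\ f \in S, b \in S,
    S \subset f |: B & S :&: K = [set b; f]].
Proof.
move=> bB KN eB fK fb.
have only v : v \in B -> v \in K -> v = b.
  by move=> vB vK; apply/set1P; rewrite -eB inE vB.
have /setIP[hb bK] : b \in B :&: K by rewrite eB !inE.
have fB : f \notin B by apply: contraNN fb => fB; apply/eqP/only.
have [S SN /andP[fS sS]] := fund_circuit bB fB.
have [g gf /andP[gS gK]] := circuit_cocircuit SN KN fS fK.
have hS v : v \in S -> v \in K -> v = b \/ v = f.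
  by move=> /(subsetP sS); rewrite !inE => /orP[/eqP->|vB vK]; [right|left;
    exact: only].
have gb : g = b by case: (hS g gS gK) => // e; rewrite e eqxx in gf.
rewrite gb in gS; exists S => //; split=> //.
apply/setP => v; rewrite !inE; apply/andP/orP => [[vS vK]|[]/eqP->//].
by case: (hS v vS vK) => ->; [left|right].
Qed.

(** This supplies the descent on the intersection with a cocircuit. All circuits are sought in
    [S :|: B], where the basis [B] contains [e] and [S :\: K] and meets [K] in [e] alone, so their
    traces on [K] stay within that of [S]. *)
Lemma modular_extension S K e : S \in N -> K \in mcocircuits N -> e \in S ->
  e \in K ->
  (2 < #|S :&: K|)%N ->
  exists2 T, T \in N & [/\ modular_pair N S T, e \in T & T :&: K \proper S :&: K].
Proof.
move=> SN KN eS eK card3.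
have [f fe /andP[fS fK]] := circuit_cocircuit SN KN eS eK.
(* This set is independent because it lies in [S :\ f]. *)
have [||B [bB sB eB]] := @basis_extend_co (e |: (S :\: K)) K e KN eK.
- apply: mindep_sub (circuit_indep SN fS); apply/subsetP => x.
  rewrite !inE => /orP[/eqP->|/andP[xK ->]]; first by rewrite eq_sym fe.
  by rewrite andbT; apply: contraNneq xK => ->.
- by move=> x; rewrite !inE => /orP[/eqP//|/andP[/negPf-> _]].
have [T0 T0N [fT0 eT0 sT0 mT0]] := fund_circuit_co bB KN eB fK fe.
pose P T := [&& T \in N, T != S & T \subset S :|: B].
(* The fundamental circuit of [f] has two elements in [K] and [S] has at least three, so they
   differ. *)
have PT0 : P T0.
  rewrite /P T0N /=; apply/andP; split.
    apply: contraTneq card3 => <-; rewrite mT0 -leqNgt cards2 ltnS leq_b1 //.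
  apply: subset_trans sT0 _; apply/subsetP => x.
  by rewrite !inE => /orP[/eqP->|->]; rewrite ?fS ?orbT.
case: (arg_minnP (fun T => #|T :\: S|) PT0) => R /and3P[RN RS sR] minR.
have RminS : R :\: S != set0.
  by rewrite setD_eq0; apply: contraNN RS => /(circuit_antichain RN SN)->.
(* all competitors inside [S :|: R] have the same trace outside [S] *)
have trace Z : Z \in N -> Z != S -> Z \subset S :|: R -> Z :\: S = R :\: S.
  move=> ZN ZS sZ; apply/eqP; rewrite eqEcard; apply/andP; split.
    by apply/subsetP => x; rewrite !inE => /andP[/negPf xS /(subsetP sZ)];
      rewrite inE xS.
  apply: minR; rewrite /P ZN ZS; apply: subset_trans sZ _.
  by rewrite subUset subsetUl sR.
(* Two distinct circuits inside [S :|: Z] already cover it: one of them differs from [S] and so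
   contains [R :\: S]; if both differ from [S], eliminating a common element of [R :\: S] can only
   produce [S]. *)
have modul Z : Z \in N -> Z != S -> Z \subset S :|: R -> modular_pair N S Z.
  move=> ZN ZS sZ; rewrite /modular_pair eq_sym ZS; apply/forall_inP => S' S'N.
  apply/forall_inP => T' T'N; apply/implyP => ne'; apply/negP => /andP[sub];
    case/negP.
  have subR : S' :|: T' \subset S :|: R.
    by apply: subset_trans sub _; rewrite subUset subsetUl.
  have outS : R :\: S \subset S' :|: T'.
    have [eS'|neS'] := eqVneq S' S.
      have /trace <- : T' \in N by [].
      + by apply: subset_trans (subsetDl _ _) (subsetUr _ _).
      + by rewrite -eS' eq_sym.
      + by apply: subset_trans subR; apply: subsetUr.
    rewrite -(trace S') // ?(subset_trans (subsetDl _ _) (subsetUl _ _)) //.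
    by apply: subset_trans subR; apply: subsetUl.
  have inS : S \subset S' :|: T'.
    have [<-|neS'] := eqVneq S' S; first exact: subsetUl.
    have [<-|neT'] := eqVneq T' S; first exact: subsetUr.
    have [i iR] := set0Pn _ RminS.
    have := iR; rewrite -(trace S') //; last first.
      by apply: subset_trans subR; apply: subsetUl.
    rewrite inE => /andP[iS iS'].
    have := iR; rewrite -(trace T') //; last first.
      by apply: subset_trans subR; apply: subsetUr.
    rewrite inE => /andP[_ iT'].
    have [W WN sW] := circuit_elim S'N T'N ne' iS' iT'.
    have [<-|WS] := eqVneq W S; first exact: subset_trans sW (subD1set _ _).
    have : i \in W :\: S.
      by rewrite trace //; apply: subset_trans subR;
        exact: subset_trans sW (subD1set _ _).
    by rewrite inE => /andP[_ /(subsetP sW)]; rewrite !inE eqxx.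
  rewrite subUset inS; apply/subsetP => x xZ; have [xS|xS] := boolP (x \in S).
    exact: (subsetP inS).
  by apply: (subsetP outS); rewrite -(trace Z) // inE xS.
have [R1 [R1N R1S sR1 eR1]] : exists Z, [/\ Z \in N, Z != S,
  Z \subset S :|: R & e \notin Z].
  have [eR|eR] := boolP (e \in R); last by exists R; split=> //; exact: subsetUr.
  have [|Z ZN sZ] := circuit_elim SN RN _ eS eR; first by rewrite eq_sym.
  have eZ : e \notin Z by apply/negP => /(subsetP sZ); rewrite !inE eqxx.
  exists Z; split=> //; first by apply: contraNneq eZ => ->.
  exact: subset_trans sZ (subD1set _ _).
(* [R1] is not contained in [B], and off [B] it can only have elements of [S :&: K]. *)
have [p pR1 pSK] : exists2 p, p \in R1 & p \in S :&: K.
  apply: contrapT => no; case: (mindepP _ (mbasis_indep bB) R1 R1N).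
  apply/subsetP => x xR1; have := subsetP sR1 x xR1; rewrite inE => /orP[xS|xR].
    apply: (subsetP sB); rewrite !inE xS andbT; apply/orP; right.
    by apply/negP => xK; apply: no; exists x; rewrite // inE xS.
  have := subsetP sR x xR; rewrite inE => /orP[xS|//].
  apply: (subsetP sB); rewrite !inE xS andbT; apply/orP; right.
  by apply/negP => xK; apply: no; exists x; rewrite // inE xS.
have [pS pK] := setIP pSK.
(* Removing [p] while retaining [e] makes the trace on [K] strictly smaller. *)
have [T TN /andP[eT sT]] := strong_elim SN R1N pS pR1 eS eR1.
have pT : p \notin T by apply/negP => /(subsetP sT); rewrite !inE eqxx.
have sTR : T \subset S :|: R.
  apply: subset_trans sT _; rewrite subDset; apply: subsetU; apply/orP; right.
  by rewrite subUset subsetUl.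
have TS : T != S by apply: contraNneq pT => ->.
exists T => //; split=> //; first exact: modul.
apply/properP; split; last by exists p; rewrite // inE negb_and pT.
apply/subsetP => x /setIP[xT xK]; rewrite inE xK andbT.
have := subsetP sTR x xT; rewrite inE => /orP[//|xR].
have := subsetP sR x xR; rewrite inE => /orP[//|xB].
by have /set1P-> : x \in [set e] by rewrite -eB inE xB.
Qed.

(** A maximal independent [J] off both cocircuits is enlarged by [f] and then extended to a basis
    [B] meeting [K'] in [g] alone. Modularity ensures that [B] meets [K] in [f] alone. *)
Lemma modular_cocircuits K K' : K \in mcocircuits N -> K' \in mcocircuits N ->
  modular_pair (mcocircuits N) K K' ->
  exists B f g, [/\ mbasis N B, B :&: K = [set f], B :&: K' = [set g],
    f \notin K' & g \notin K].
Proof.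
move=> KN K'N /andP[neK /forall_inP modK].
have [f fK fK'] : exists2 f, f \in K & f \notin K'.
  by apply/subsetPn; apply: contraNN neK => /(cocircuit_antichain KN K'N)->.
have [g gK' gK] : exists2 f, f \in K' & f \notin K.
  by apply/subsetPn; apply: contraNN neK => /(cocircuit_antichain K'N KN)->.
have [B1 bB1 _] := cocircuit_basis KN fK.
have i0 : mindep N set0 by apply: mindep_sub (mbasis_indep bB1); exact: sub0set.
have [J [iJ _ sJ hJ]] := max_indep i0 (sub0set (~: (K :|: K'))).
have inJ x : x \in J -> (x \notin K) && (x \notin K').
  by move=> /(subsetP sJ); rewrite !inE negb_or.
have iJf : mindep N (f |: J).
  apply: mindepU1 iJ _ => -[/inJ|[S SN /andP[fS sS]]]; first by rewrite fK.
  have [h hf /andP[hS hK]] := circuit_cocircuit SN KN fS fK.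
  by have := subsetP sS h hS; rewrite !inE (negPf hf) => /inJ; rewrite hK.
have [|B [bB sB eB']] := basis_extend_co K'N gK' iJf.
  by move=> x; rewrite !inE => /orP[/eqP->|/inJ/andP[_ /negPf->]//];
    rewrite (negPf fK').
have fB : f \in B by apply: (subsetP sB); rewrite !inE eqxx.
have gB : g \in B by have /setIP[] : g \in B :&: K' by rewrite eB' !inE.
have avoid A z : A \in mcocircuits N -> [disjoint J & A] -> spans J z -> z \notin A.
  move=> AN dJA [zJ|[S SN /andP[zS sS]]]; first by rewrite (disjointFr dJA).
  apply/negP => zA; have [h hz /andP[hS hA]] := circuit_cocircuit SN AN zS zA.
  by have := subsetP sS h hS; rewrite !inE (negPf hz) /= => /(disjointFr dJA);
    rewrite hA.
(* Given a further element [x], the fundamental cocircuits of [f] and [g] in [B] would avoid the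
   closure of [J], hence lie in [K :|: K'], and both would miss [x]. *)
have onlyf x : x \in B -> x \in K -> x = f.
  move=> xB xK; apply/eqP/negPn/negP => xf.
  have [A AN eA] := fund_cocircuit bB fB.
  have [A' A'N eA'] := fund_cocircuit bB gB.
  have xg : x != g by apply: contraNneq gK => <-.
  have fg : f != g by apply: contraNneq gK => <-.
  have disj D b : b \notin J -> B :&: D = [set b] -> [disjoint J & D].
    move=> bJ eD; rewrite disjoint_subset; apply/subsetP => v vJ; rewrite inE.
    apply: contraNN bJ => vD; have /set1P<- // : v \in [set b].
    by rewrite -eD inE vD andbT; apply: (subsetP sB); rewrite !inE vJ orbT.
  have dA : [disjoint J & A] by apply: (disj _ f) => //; apply/negP => /inJ;
    rewrite fK.
  have dA' : [disjoint J & A'].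
    by apply: (disj _ g) => //; apply/negP => /inJ; rewrite gK' andbF.
  have := modK A AN => /forall_inP/(_ A' A'N)/implyP; case/(_ _)/negP.
    apply/eqP => eAA; move: eA'; rewrite -eAA eA => /setP/(_ f).
    by rewrite !inE eqxx (negPf fg).
  apply/properP; split.
    apply/subsetP => v; rewrite inE => vAA; apply/negPn/negP => vK.
    have sv : spans J v by apply: hJ; rewrite inE.
    by move: vAA; rewrite (negPf (avoid A v AN dA sv))
      (negPf (avoid A' v A'N dA' sv)).
  exists x; first by rewrite inE xK.
  rewrite inE negb_or; apply/andP; split; apply/negP => xA.
    by move/setP: eA => /(_ x); rewrite !inE xB xA (negPf xf).
  by move/setP: eA' => /(_ x); rewrite !inE xB xA (negPf xg).
exists B, f, g; split=> //.
by apply/setP => v; rewrite !inE; apply/andP/eqP => [[]|->]; first exact: onlyf.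
Qed.

End CircuitMatroid.

(** * Order, arithmetic and finite hypersums in [Gamma_max] *)

Section GammaMaxOrder.
Variables (d : Order.disp_t) (Gamma : orderedGroupType d).
Notation G0 := (option Gamma).
Implicit Types (a x y z : G0) (s : seq G0).

Lemma gle0 x : gle x None -> x = None.
Proof. by case: x. Qed.

Lemma gle_neq0 x y : gle x y -> x <> None -> y <> None.
Proof. by move=> h nx ey; apply: nx; apply: gle0; rewrite -ey. Qed.

Lemma gmulKl a x : a <> None -> gmul (ginv a) (gmul a x) = x.
Proof. by move=> /eqP a0; rewrite gmulA gmulVl // gmul1l. Qed.

Lemma gmulVK a x : a <> None -> gmul a (gmul (ginv a) x) = x.
Proof. by move=> /eqP a0; rewrite gmulA gmulVr // gmul1l. Qed.

Lemma gmulKr a x : a <> None -> gmul (gmul x a) (ginv a) = x.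
Proof. by move=> /eqP a0; rewrite -gmulA gmulVr // gmul1r. Qed.

Lemma gmulKV a x : a <> None -> gmul (gmul x (ginv a)) a = x.
Proof. by move=> /eqP a0; rewrite -gmulA gmulVl // gmul1r. Qed.

Lemma gmul_neq0 x y : gmul x y <> None <-> x <> None /\ y <> None.
Proof. by case: x y => [x|] [y|] //=; split=> // -[]. Qed.

Lemma ginv_neq0 x : ginv x <> None <-> x <> None.
Proof. by case: x. Qed.

Lemma gmul_injl a x y : a <> None -> gmul a x = gmul a y -> x = y.
Proof. by move=> a0 e; rewrite -(gmulKl x a0) e gmulKl. Qed.

Lemma gle_cancell a x y : a <> None -> gle (gmul a x) (gmul a y) -> gle x y.
Proof.
by move=> a0 /(gle_mul2l (ginv a)); rewrite !gmulKl.
Qed.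

Lemma gle_cancelr a x y : a <> None -> gle (gmul x a) (gmul y a) -> gle x y.
Proof.
by move=> a0 /(gle_mul2r (ginv a)); rewrite !gmulKr.
Qed.

Lemma gmax_lel x y : gle x (gmax x y).
Proof. by rewrite /gmax; case: ifP => // _; exact: glexx. Qed.

Lemma gmax_ler x y : gle y (gmax x y).
Proof.
rewrite /gmax; case: ifP => h; first exact: glexx.
by have := gle_total x y; rewrite h.
Qed.

Lemma gadd_le x y z m : gadd x y z -> gle x m -> gle y m -> gle z m.
Proof.
case/gaddP => -[e h] hx hy; [exact: gle_trans h hx|by rewrite -e|by rewrite -e].
Qed.

Lemma gadd_cancell a x y z :
  a <> None -> gadd (gmul a x) (gmul a y) (gmul a z) -> gadd x y z.
Proof.
move=> a0 /gaddP[] [e h]; apply/gaddP;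
  [constructor 1 | constructor 2 | constructor 3];
  by split; [exact: gmul_injl e | exact: gle_cancell h].
Qed.

Lemma gadd_three x y z :
  (x <> None -> gle x y \/ gle x z) -> (y <> None -> gle y x \/ gle y z) ->
  (z <> None -> gle z x \/ gle z y) -> gadd x y z.
Proof.
have nn (u v w : G0) : (u <> None -> gle u v \/ gle u w) -> gle u v \/ gle u w.
  by case: u => [u|] h; [exact: h | left].
move=> /nn hx /nn hy /nn hz; apply/gaddP.
have tot (u v : G0) : gle u v \/ gle v u by apply/orP/gle_total.
have [xy|yx] := tot x y.
  have [yz|zy] := tot y z.
    constructor 3; split=> //; apply: gle_anti yz _.
    by case: hz => // h; exact: gle_trans h xy.
  case: hy => h; last by constructor 3; split=> //; exact: gle_anti.
  have e := gle_anti xy h; by constructor 1; rewrite e.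
have [xz|zx] := tot x z.
  constructor 2; split=> //; apply: gle_anti xz _.
  by case: hz => // h; exact: gle_trans h yx.
case: hx => h; last by constructor 2; split=> //; exact: gle_anti.
by constructor 1; split=> //; exact: gle_anti.
Qed.

Definition gmaxs s : G0 := foldr (@gmax d Gamma) None s.

Lemma gle_gmaxs s x : x \in s -> gle x (gmaxs s).
Proof.
elim: s => //= y s IHs; rewrite inE => /orP[/eqP->|/IHs h]; first exact: gmax_lel.
exact: gle_trans h (gmax_ler _ _).
Qed.

Lemma gmaxs_mem s : gmaxs s <> None -> gmaxs s \in s.
Proof.
elim: s => //= y s IHs; rewrite {1 2}/gmax; case: ifP => _ h; rewrite inE ?eqxx //.
by rewrite IHs ?orbT.
Qed.

(** Induction on the list: a head below the maximum of the tail changes nothing, a tie opens the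
    whole down-set, and a strictly larger head absorbs the rest. The value [None] for the maximum of
    an empty list forces its sum to be zero. *)
Lemma hsum_gaddP (I : Type) (r : seq I) (F : I -> G0) z :
  (\big[hadd_set (@gadd d Gamma)/classical_sets.set1 None]_(i <- r)
     classical_sets.set1 (F i)) z <->
  gle z (gmaxs (map F r)) /\
  (count_mem (gmaxs (map F r)) (map F r) = 1 -> z = gmaxs (map F r)).
Proof.
elim: r z => [|i r IHr] z.
  rewrite big_nil /=; split=> [->//|[/gle0->]//].
rewrite big_cons /=; set s := map F r in IHr *; set x := F i; set m :=
  gmaxs s in IHr *.
transitivity (exists2 w, gle w m /\ (count_mem m s = 1 -> w = m) & gadd x w z).
  split=> [[_ -> [w /IHr hw h]]|[w /IHr hw h]]; first by exists w.
  by exists x => //; exists w.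
have m0 : count_mem m s = 0 -> m = None.
  move=> c0; apply: contrapT => /gmaxs_mem; rewrite -/m -has_pred1 has_count c0 //.
have [exm|nxm] := eqVneq x m.
  rewrite exm /gmax glexx eqxx; split=> [[w [hw _] h]|[hz _]].
    split; first exact: gadd_le h (glexx _) hw.
    move=> [] /m0 em; move: h hw; rewrite em => h /gle0 ew.
    by apply: gle0; apply: gadd_le h _ _; rewrite ?ew.
  by exists m; [split=> //; exact: glexx | apply/gaddP; constructor 1].
have [xm|nle] := boolP (gle x m).
  rewrite /gmax xm (negPf nxm) add0n; split=> [[w [hw hc] h]|[hz hc]].
    split=> [|c1]; first exact: gadd_le h xm hw.
    move: h; rewrite (hc c1) => /gaddP[] [] // e h'; first by rewrite e eqxx in nxm.
    by case/eqP: nxm; apply: gle_anti.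
  (* The partial sum is [z] itself if [z] lies above the head [x]; otherwise it is [x], whose tie
     with the head yields everything below. *)
  have [xz|zx] := orP (gle_total x z).
    by exists z => //; apply/gaddP; constructor 3.
  exists x; last by apply/gaddP; constructor 1.
  split=> // /hc ez; case/eqP: nxm; apply: gle_anti => //; by rewrite -ez.
have mx : gle m x by have := gle_total x m; rewrite (negPf nle).
rewrite /gmax (negPf nle) eqxx.
have -> : count_mem x s = 0.
  apply/eqP; rewrite -leqn0 leqNgt -has_count has_pred1.
  by apply: contraNN nle; exact: gle_gmaxs.
split=> [[w [hw _] h]|[_ /(_ erefl) ->]].
  have ez : z = x.
    case/gaddP: h => -[] // e h; first by rewrite e hw in nle.
    by rewrite (gle_trans h hw) in nle.
  by rewrite ez; split=> //; exact: glexx.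
exists m; first by split=> //; exact: glexx.
by apply/gaddP; constructor 2.
Qed.

End GammaMaxOrder.

(** * Orthogonality, composition and scaling *)

Section Orthogonality.
Variables (d : Order.disp_t) (Gamma : orderedGroupType d) (E : finType).
Notation G0 := (option Gamma).
Notation vec := {ffun E -> GammaMax Gamma}.
Implicit Types (X Y Z W V : vec) (e f g h : E).

Lemma suppP X e : reflect (X e <> None) (e \in supp X).
Proof. by rewrite inE; apply: (iffP idP) => [/eqP|h] //; apply/eqP. Qed.

Lemma supp_notin X e : e \notin supp X -> X e = None.
Proof. by move=> /suppP h; apply: contrapT. Qed.

Definition prodv X Y e : G0 := gmul (X e) (Y e).

Lemma prodv_neq0 X Y e : prodv X Y e <> None <-> e \in supp X /\ e \in supp Y.
Proof.
by rewrite /prodv gmul_neq0; split=> -[] /suppP h1 /suppP h2.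
Qed.

(** That the maximum is not attained exactly once becomes a local condition, which spares later
    arguments any counting. *)
Lemma orthP X Y : orthogonal X Y <->
  forall e, prodv X Y e <> None -> exists2 f, f != e & gle (prodv X Y e)
    (prodv X Y f).
Proof.
rewrite /orthogonal; set r := index_enum E.
apply: iff_trans (hsum_gaddP r (prodv X Y) None) _.
set s := map _ r; set m := gmaxs s.
have memr e : prodv X Y e \in s by apply: map_f; rewrite mem_index_enum.
have cntE : count_mem m s = #|[set e | prodv X Y e == m]|.
  rewrite /s count_map -sum1_count -sum1_card; apply: eq_bigl => e.
  by rewrite !inE.
have wit : m <> None -> exists e, prodv X Y e = m.
  by move=> /gmaxs_mem/mapP[e _ em]; exists e; rewrite -em.
rewrite cntE; split=> [[_ h] e ne|h].
  have le_em := gle_gmaxs (memr e); rewrite -/m in le_em.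
  have nm := gle_neq0 le_em ne; apply: contrapT => no.
  have nof f : prodv X Y f = m -> f = e.
    move=> ef; apply: contrapT => /eqP nfe; apply: no; exists f => //.
    by rewrite ef.
  apply: (nm); rewrite -h //; apply/eqP/cards1P; exists e; apply/setP => f.
  rewrite !inE; apply/eqP/eqP => [/nof//|->].
  by have [f' ef'] := wit nm; rewrite -(nof _ ef').
split=> // /eqP/cards1P[e es]; apply: contrapT => nm.
have nm' : m <> None by move=> em; apply: nm; rewrite em.
have ee : prodv X Y e = m by apply/eqP; have := set11 e; rewrite -es inE.
have [|f fe] := h e; rewrite ee // => lef.
have : f \in [set e].
  by rewrite -es inE; apply/eqP/gle_anti => //; exact: gle_gmaxs.
by rewrite inE (negPf fe).
Qed.

Lemma orth_two X Y f g : orthogonal X Y -> f != g ->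
  (forall h, h \in supp X -> h \in supp Y -> h = f \/ h = g) ->
  prodv X Y f = prodv X Y g.
Proof.
move=> /orthP o; wlog suff : f g / f != g ->
    (forall h, h \in supp X -> h \in supp Y -> h = f \/ h = g) ->
    gle (prodv X Y f) (prodv X Y g).
  move=> hw fg hs; apply: gle_anti; apply: hw => //; first by rewrite eq_sym.
  by move=> h h1 h2; case: (hs h h1 h2); [right|left].
move=> fg hs; case ef: (prodv X Y f) => [u|] //; rewrite -ef.
have [|h hf le] := o f; first by rewrite ef.
have nh : prodv X Y h <> None by apply: gle_neq0 le _; rewrite ef.
case/prodv_neq0: nh => h1 h2; case: (hs h h1 h2) => eh; last by rewrite -eh.
by rewrite eh eqxx in hf.
Qed.

Lemma orth_three X Y f g e : orthogonal X Y ->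
  (forall h, h \in supp X -> h \in supp Y -> [\/ h = f, h = g | h = e]) ->
  gadd (prodv X Y f) (prodv X Y g) (prodv X Y e).
Proof.
move=> /orthP o hs.
have key x : prodv X Y x <> None -> exists2 h, h != x &
    gle (prodv X Y x) (prodv X Y h) /\ [\/ h = f, h = g | h = e].
  move=> nx; have [h hx le] := o x nx; exists h => //; split=> //.
  by case/prodv_neq0: (gle_neq0 le nx); exact: hs.
apply: gadd_three => /key[h hx [le []]] eh; subst h; rewrite ?eqxx // in hx *;
  by [left|right].
Qed.

Lemma orth0 Y : orthogonal (vzero (GammaMax Gamma) E) Y.
Proof. by apply/orthP => e; rewrite /prodv ffunE. Qed.

(** Every product of the composition comes from [X] or from [X'], and the dominating product found
    there only grows under composition. *)
Lemma orth_vcomp X X' Y : orthogonal X Y -> orthogonal X' Y ->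
  orthogonal (vcomp X X') Y.
Proof.
move=> /orthP o /orthP o'; apply/orthP => e.
have le1 f : gle (prodv X Y f) (prodv (vcomp X X') Y f).
  by rewrite /prodv ffunE; apply/gle_mul2r/gmax_lel.
have le2 f : gle (prodv X' Y f) (prodv (vcomp X X') Y f).
  by rewrite /prodv ffunE; apply/gle_mul2r/gmax_ler.
have [->|->] : prodv (vcomp X X') Y e = prodv X Y e \/
    prodv (vcomp X X') Y e = prodv X' Y e.
- by rewrite /prodv ffunE /gmax; case: ifP; [right|left].
- by move=> /o[f fe h]; exists f => //; exact: gle_trans h (le1 f).
- by move=> /o'[f fe h]; exists f => //; exact: gle_trans h (le2 f).
Qed.

Lemma big_vcomp_ub (I : eqType) (r : seq I) (F : I -> vec) i e : i \in r ->
  gle (F i e) ((\big[@vcomp d Gamma E/vzero (GammaMax Gamma) E]_(j <- r) F j) e).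
Proof.
elim: r => // j r IHr; rewrite inE big_cons ffunE => /orP[/eqP->|/IHr h].
  exact: gmax_lel.
exact: gle_trans h (gmax_ler _ _).
Qed.

Lemma big_vcomp_le (I : Type) (r : seq I) (F : I -> vec) V :
  (forall i e, gle (F i e) (V e)) -> forall e,
  gle ((\big[@vcomp d Gamma E/vzero (GammaMax Gamma) E]_(j <- r) F j) e) (V e).
Proof.
move=> hF e; elim: r => [|j r IHr]; first by rewrite big_nil ffunE.
by rewrite big_cons ffunE /gmax; case: ifP.
Qed.

Lemma supp_lscale (a : G0) X : a <> None ->
  supp (lscale (a : GammaMax Gamma) X) = supp X.
Proof.
move=> a0; apply/setP => e; apply/suppP/suppP; rewrite ffunE.
  by case/gmul_neq0.
by move=> h; apply/gmul_neq0.
Qed.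

Lemma supp_rscale (a : G0) X : a <> None ->
  supp (rscale (a : GammaMax Gamma) X) = supp X.
Proof.
move=> a0; apply/setP => e; apply/suppP/suppP; rewrite ffunE.
  by case/gmul_neq0.
by move=> h; apply/gmul_neq0.
Qed.

Lemma gmax_attained (P : {set E}) (F : E -> G0) e0 : e0 \in P ->
  exists2 g, g \in P & forall f, f \in P -> gle (F f) (F g).
Proof.
move=> e0P.
have := @extremumP _ _ (fun x y : G0 => gle y x) e0 (mem P) F.
case=> //; first exact: glexx.
- by move=> y x z h1 h2; exact: gle_trans h2 h1.
- by move=> x y; exact: gle_total.
by move=> g gP h; exists g.
Qed.

(** The index [g] maximises [gmul (W f) (ginv (V f))], and [a] is the inverse of that maximum
    conjugated into [gmul (V g) (ginv (W g))]. As [a] acts on the left, the quotients are taken on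
    the right, which is what a nonabelian group requires. *)
Lemma tight_scaling (P : {set E}) W V e0 : e0 \in P -> P \subset supp W ->
  P \subset supp V ->
  exists a g, [/\ a <> None, g \in P, gmul a (W g) = V g &
    forall f, f \in P -> gle (gmul a (W f)) (V f)].
Proof.
move=> e0P /subsetP sW /subsetP sV.
have [g gP max] := gmax_attained (fun f => gmul (W f) (ginv (V f))) e0P.
have /suppP Wg := sW g gP; have /suppP Vg := sV g gP.
have Wi := (ginv_neq0 (W g)).2 Wg.
exists (gmul (V g) (ginv (W g))), g; split=> //.
- exact/gmul_neq0.
- exact: gmulKV.
move=> f fP; have /suppP Vf := sV f fP.
have := gle_mul2r (V f) (max f fP); rewrite gmulKV //.
move/(gle_mul2l (gmul (V g) (ginv (W g)))); congr (is_true (gle _ _)).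
by rewrite -!gmulA gmulKl // gmulVK.
Qed.

End Orthogonality.

(** * The underlying matroid of a left [Gamma_max]-matroid *)

Section LeftMatroid.
Variables (d : Order.disp_t) (Gamma : orderedGroupType d) (E : finType).
Variable M : leftMatroid (GammaMax Gamma) E.
Notation G0 := (option Gamma).
Notation vec := {ffun E -> GammaMax Gamma}.
Notation C := (circuits M).
Notation N := (supports (circuits M)).
Implicit Types (X Y Z W V : vec) (e f g h : E) (A B K S T : {set E}) (a : G0).

Lemma circuit_neq0 X : C X -> exists e, X e <> None.
Proof.
have [h0 _ _ _] := circuitsP M; move=> CX; apply: contrapT => no; apply: h0.
suff <- : X = vzero (GammaMax Gamma) E by [].
apply/ffunP => e; rewrite ffunE; apply: contrapT => h; apply: no; by exists e.
Qed.

Lemma circuit_lscale a X : a <> None -> C X -> C (lscale (a : GammaMax Gamma) X).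
Proof. by have [_ h _ _] := circuitsP M; move=> /eqP a0; exact: h. Qed.

Lemma supp_circuit X : C X -> supp X \in N.
Proof. by move=> CX; rewrite inE; apply/asboolP; exists X. Qed.

Lemma circuit_supp S : S \in N -> exists2 X, C X & supp X = S.
Proof. by rewrite inE => /asboolP. Qed.

Lemma circuit_scaled S e a : S \in N -> e \in S -> a <> None ->
  exists X, [/\ C X, supp X = S & X e = a].
Proof.
move=> /circuit_supp[X CX <-] /suppP Xe a0.
have b0 : gmul a (ginv (X e)) <> None by apply/gmul_neq0; split=> //;
  apply/ginv_neq0.
exists (lscale (gmul a (ginv (X e)) : GammaMax Gamma) X); split.
- exact: circuit_lscale.
- exact: supp_lscale.
- by rewrite ffunE; exact: gmulKV.
Qed.

Lemma supp_antichain S T : S \in N -> T \in N -> S \subset T -> S = T.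
Proof.
have [_ _ h _] := circuitsP M.
move=> /circuit_supp[X CX <-] /circuit_supp[Y CY <-] /(h X Y CX CY)[a /eqP a0 ->].
by rewrite supp_lscale.
Qed.

Lemma circuit_eq X X' e : C X -> C X' -> supp X = supp X' -> X e = X' e ->
  X e <> None -> X = X'.
Proof.
have [_ _ h _] := circuitsP M; move=> CX CX' es ee ne.
have [|a /eqP a0 eX'] := h X X' CX CX'; first by rewrite es.
apply/ffunP => f; rewrite eX' ffunE; move: ee; rewrite eX' ffunE => ee.
suff -> : a = Some 1%g by exact/esym/gmul1l.
have : gmul (gmul a (X e)) (ginv (X e)) = gmul (X e) (ginv (X e)).
  by congr (gmul _ _); rewrite {2}ee.
by rewrite gmulKr // gmulVr //; apply/eqP.
Qed.

(** Negation in [GammaMax] is the identity, so the elimination axiom applies to circuits that agree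
    at [e]. *)
Lemma modular_elim X Y e : C X -> C Y -> modular_pair N (supp X) (supp Y) ->
  X e = Y e -> X e <> None ->
  exists Z, [/\ C Z, Z e = None & forall f, gadd (X f) (Y f) (Z f)].
Proof.
have [_ _ _ h] := circuitsP M; move=> CX CY m ee /eqP ne.
by have [Z [CZ Ze hZ]] := h X Y e CX CY m ee ne; exists Z.
Qed.

Lemma supp_gadd X Y Z f : gadd (X f) (Y f) (Z f) -> f \in supp Z ->
  f \in supp X \/ f \in supp Y.
Proof.
move=> hf /suppP Zf; apply: contrapT =>
  /not_orP[/negP/supp_notin hX /negP/supp_notin hY].
by apply: Zf; apply: gle0; apply: gadd_le hf _ _; rewrite ?hX ?hY.
Qed.

(* A non-modular pair contains a pair with smaller union, so ordinary
   circuit elimination follows from elimination of modular pairs. *)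
Lemma supp_elim S T e : S \in N -> T \in N -> S != T -> e \in S -> e \in T ->
  exists2 Z, Z \in N & Z \subset (S :|: T) :\ e.
Proof.
move: {2}(#|S :|: T|).+1 (ltnSn #|S :|: T|) => n.
elim: n S T => // n IHn S T; rewrite ltnS => le_n SN TN neST eS eT.
have [m|] := boolP (modular_pair N S T).
  have [X CX sX] := circuit_supp SN.
  have /suppP Xe : e \in supp X by rewrite sX.
  have [Y [CY sY Ye]] := circuit_scaled TN eT Xe.
  have [|||Z [CZ Ze hZ]] := @modular_elim X Y e CX CY; rewrite ?sX ?sY //.
  exists (supp Z); first exact: supp_circuit.
  apply/subsetP => f fZ; rewrite in_setD1 in_setU; apply/andP; split.
    by apply: contraTneq fZ => ->; apply/suppP; rewrite Ze.
  by apply/orP; rewrite -sX -sY; exact: supp_gadd (hZ f) fZ.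
rewrite /modular_pair neST /= => /forall_inPn[S' S'N /forall_inPn[T' T'N]].
rewrite negb_imply negbK => /andP[ne' pr].
have sub A : A \subset S' :|: T' -> e \notin A -> A \subset (S :|: T) :\ e.
  move=> sA eA; apply/subsetP => f fA; rewrite in_setD1.
  rewrite (subsetP (proper_sub pr)) ?(subsetP sA) // andbT.
  by apply: contraNneq eA => <-.
have [eS'|eS'] := boolP (e \in S'); last by exists S' => //; apply: sub;
  rewrite ?subsetUl.
have [eT'|eT'] := boolP (e \in T'); last by exists T' => //; apply: sub;
  rewrite ?subsetUr.
have [|Z ZN sZ] := IHn S' T' _ S'N T'N ne' eS' eT'.
  exact: leq_trans (proper_card pr) le_n.
exists Z => //; apply: sub; first exact: subset_trans sZ (subD1set _ _).
by apply/negP => /(subsetP sZ); rewrite !inE eqxx.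
Qed.

Let Nac := supp_antichain.
Let Nel := supp_elim.

Lemma mbasis_exists : exists B, mbasis N B.
Proof.
have i0 : mindep N set0.
  apply/mindepP => S /circuit_supp[X /circuit_neq0[e /suppP eX] <-].
  by rewrite subset0 => /eqP s0; rewrite s0 inE in eX.
have [J [iJ _ _ hJ]] := max_indep i0 (sub0set [set: E]).
by exists J; apply/mbasisP; split=> // z; apply: hJ; rewrite inE.
Qed.

(** * Construction of cocircuits and their orthogonality to circuits *)

Lemma cocircuit_neq0 K : K \in mcocircuits N -> exists e, e \in K.
Proof.
have [B bB] := mbasis_exists; move=> /cocircuitP[/(_ B bB)[x _ xK] _]; by exists x.
Qed.

(** Induction on [B :\: B']. An exchange brings [B] closer to [B'], and induction handles the
    fundamental circuit [X1] of [g] in the new basis, scaled to agree at [f]. Since [X] and [X1]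
    form a modular pair unless their supports coincide, eliminating [f] compares them at [g]. *)
Lemma cocircuit_ratio_basis K B B' f g X X' : K \in mcocircuits N ->
  mbasis N B -> mbasis N B' -> B :&: K = [set f] -> B' :&: K = [set f] ->
  g \in K -> g != f -> C X -> C X' -> supp X \subset g |: B ->
  supp X' \subset g |: B' -> X f = X' f -> X f <> None -> X g = X' g.
Proof.
move: {2}(#|B :\: B'|).+1 (ltnSn #|B :\: B'|) => n.
elim: n B X => // n IHn B X; rewrite ltnS =>
  le_n KN bB bB' eB eB' gK gf CX CX' sX sX' ef nf.
have [sBB'|/subsetPn[x xB xB']] := boolP (B \subset B').
  have eBB := mbasis_sub bB bB' sBB'; rewrite eBB in sX'.
  have es := fund_circuit_uniq Nel (mbasis_indep bB) (supp_circuit CX)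
    (supp_circuit CX') sX sX'.
  by rewrite (circuit_eq CX CX' es ef nf).
have inB v : v \in B -> v \in K -> v = f by move=> h1 h2; apply/set1P;
  rewrite -eB inE h1.
have inB' v : v \in B' -> v \in K -> v = f by move=> h1 h2; apply/set1P;
  rewrite -eB' inE h1.
have /setIP[fB fK] : f \in B :&: K by rewrite eB inE.
have /setIP[fB' _] : f \in B' :&: K by rewrite eB' inE.
have [y /andP[yB' yB] bB1] := basis_exchange Nac Nel bB bB' xB xB'.
have yK : y \notin K by apply: contraNN yB => /(inB' y yB')->.
have xf : x != f by apply: contraNneq xB' => ->.
have eB1 : (y |: (B :\ x)) :&: K = [set f].
  apply/setP => v; rewrite !inE; apply/andP/eqP =>
    [[/orP[/eqP->|/andP[_ vB]] vK]|->].
  - by rewrite vK in yK.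
  - exact: inB.
  - by rewrite fB fK [f == x]eq_sym xf orbT.
have [S1 S1N [gS1 fS1 sS1 mS1]] := fund_circuit_co Nac Nel bB1 KN eB1 gK gf.
have [X1 [CX1 sX1 X1f]] := circuit_scaled S1N fS1 nf.
have X1g : X1 g = X' g.
  apply: (IHn (y |: (B :\ x)) X1) => //; rewrite ?sX1 ?X1f //.
  apply: leq_trans le_n; apply: proper_card; apply/properP; split.
    apply/subsetP => v; rewrite !inE => /andP[vB' /orP[/eqP ev|/andP[_ ->]]].
      by rewrite ev yB' in vB'.
    by rewrite vB'.
  by exists x; rewrite !inE ?xB ?xB' // eqxx /= orbF; apply: contraNN yB => /eqP<-.
rewrite -X1g; have [es|ns] := eqVneq (supp X) (supp X1).
  by rewrite (circuit_eq CX CX1 es (esym X1f)).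
have sX1B : supp X1 \subset y |: (g |: B).
  rewrite sX1; apply: subset_trans sS1 _; apply/subsetP => v; rewrite !inE.
  by case/or3P=> [->|->|/andP[_ ->]]; rewrite ?orbT.
have mod : modular_pair N (supp X) (supp X1).
  apply: (basis_modular Nac Nel (mbasis_indep bB) (supp_circuit CX)
    (supp_circuit CX1) ns _ sX1B).
  exact: subset_trans sX (subsetUr _ _).
have [|Z [CZ Zf hZ]] := modular_elim CX CX1 mod _ nf; first by rewrite X1f.
(* If [Z] contained [g], it would meet [K] again, necessarily in [B] and so at [f], where it
   vanishes. A sum containing zero at [g] means equality there. *)
suff Zg : Z g = None.
  by have := hZ g; rewrite Zg => /gaddN ->.
apply: contrapT => /suppP gZ.
have [h hg /andP[hZ' hK]] := circuit_cocircuit Nac Nel (supp_circuit CZ) KN gZ gK.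
have : h \in y |: (g |: B).
  case: (supp_gadd (hZ h) hZ') => [/(subsetP sX) hh|/(subsetP sX1B)//].
  exact: (subsetP (subsetUr _ _)).
rewrite !in_setU1 (negPf hg) /= => /orP[/eqP ey|hB].
  by rewrite ey (negPf yK) in hK.
by move/suppP: hZ'; rewrite (inB h hB hK) Zf.
Qed.

(** Without [g], each circuit extends to a basis meeting [K] in [f] alone; both are thus fundamental
    circuits of [g]. *)
Lemma cocircuit_ratio K f g X X' : K \in mcocircuits N -> f != g ->
  C X -> C X' -> supp X :&: K = [set f; g] -> supp X' :&: K = [set f; g] ->
  X f = X' f -> X g = X' g.
Proof.
move=> KN fg CX CX' sX sX' ef.
have key W : C W -> supp W :&: K = [set f; g] ->
  exists B, [/\ mbasis N B, supp W \subset g |: B & B :&: K = [set f]].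
  move=> CW sW; have /setIP[gW gK] : g \in supp W :&: K
    by rewrite sW !inE eqxx orbT.
  have /setIP[fW fK] : f \in supp W :&: K by rewrite sW !inE eqxx.
  have [|B [bB sB eB]] :=
    basis_extend_co Nac Nel KN fK (circuit_indep Nac (supp_circuit CW) gW).
    move=> x /setD1P[xg xW] xK.
    have : x \in [set f; g] by rewrite -sW inE xW.
    by rewrite !inE (negPf xg) orbF => /eqP.
  by exists B; split=> //; rewrite -subDset.
have [B [bB sB eB]] := key X CX sX; have [B' [bB' sB' eB']] := key X' CX' sX'.
have /setIP[fW fK] : f \in supp X :&: K by rewrite sX !inE eqxx.
have /setIP[_ gK] : g \in supp X :&: K by rewrite sX !inE eqxx orbT.
apply: (cocircuit_ratio_basis KN bB bB' eB eB' gK _ CX CX' sB sB' ef).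
  by rewrite eq_sym.
exact/suppP.
Qed.

(* The circuits of the dual, characterised by the circuits of [M] that they
   meet in exactly two elements. *)
Definition dual_vector Y : Prop :=
  supp Y \in mcocircuits N /\
  forall X f g, C X -> f != g -> supp X :&: supp Y = [set f; g] ->
    prodv X Y f = prodv X Y g.

Lemma dual_vector_scale Y a : a <> None -> dual_vector Y ->
  dual_vector (rscale (a : GammaMax Gamma) Y).
Proof.
move=> a0 [sY hY]; split; first by rewrite supp_rscale.
move=> X f g CX fg; rewrite supp_rscale // => es; rewrite /prodv !ffunE.
have := hY X f g CX fg es; rewrite /prodv /= => h.
by rewrite !gmulA h.
Qed.

(** The value at [e] is set to one and the value at [f] is read off the fundamental circuit [F f],
    scaled to one at [e]. Pairs containing [e] follow from the constant ratio; for other pairs,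
    eliminating [e] between [F f] and [F g] gives a circuit meeting [K] in exactly these two
    elements. *)
Lemma dual_vector_exists K : K \in mcocircuits N ->
  exists2 Y, dual_vector Y & supp Y = K.
Proof.
move=> KN; have [e eK] := cocircuit_neq0 KN.
have [B bB eB] := cocircuit_basis KN eK.
have /boolp.choice[F hF] : forall f, exists W, f \in K -> f != e ->
    [/\ C W, W e = Some 1%g, supp W \subset f |: B & supp W :&: K = [set e; f]].
  move=> f.
  have [fK|fK] := boolP (f \in K); last by exists (vzero (GammaMax Gamma) E).
  have [->|fe] := eqVneq f e; first by exists (vzero (GammaMax Gamma) E).
  have [S SN [fS eS sS mS]] := fund_circuit_co Nac Nel bB KN eB fK fe.
  have [|W [CW sW We]] := @circuit_scaled S e (Some 1%g) SN eS; first by [].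
  by exists W; rewrite sW.
have Ff f : f \in K -> f != e -> F f f <> None.
  move=> fK fe; have [_ _ _ es] := hF f fK fe; apply/suppP.
  by have /setIP[] : f \in supp (F f) :&: K by rewrite es !inE eqxx orbT.
pose Y : vec := [ffun f => (if f == e then Some 1%g else
  if f \in K then ginv (F f f) else None) : GammaMax Gamma].
have Ye : Y e = Some 1%g by rewrite ffunE eqxx.
have Yf f : f \in K -> f != e -> Y f = ginv (F f f).
  by move=> fK fe; rewrite ffunE (negPf fe) fK.
have sY : supp Y = K.
  apply/setP => f; apply/suppP/idP; rewrite ffunE.
    by case: eqP => [->//|_]; case: ifP.
  move=> fK; rewrite fK; case: eqP => // /eqP fe; apply/ginv_neq0; exact: Ff.
exists Y => //; split; rewrite sY // => X f g CX fg es.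
have base h W : h \in K -> h != e -> C W -> supp W :&: K = [set e; h] ->
    gmul (W e) (Y e) = gmul (W h) (Y h).
  move=> hK he CW sW; have [CF Fe _ sF] := hF h hK he.
  have We : W e <> None.
    by apply/suppP; have /setIP[] : e \in supp W :&: K by rewrite sW !inE eqxx.
  have eh : e != h by rewrite eq_sym.
  have <- : gmul (W e) (F h h) = W h.
    have := cocircuit_ratio KN eh (circuit_lscale We CF) CW.
    by rewrite supp_lscale // !ffunE Fe => /(_ sF sW (gmul1r _)).
  by rewrite Ye Yf //= gmulKr ?gmul1r //; exact: Ff.
have [fK gK] : f \in K /\ g \in K.
  by split; [have /setIP[] : f \in supp X :&: K by rewrite es !inE eqxx|
    have /setIP[] : g \in supp X :&: K by rewrite es !inE eqxx orbT].
have [ef|fe] := eqVneq f e.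
  rewrite ef in fg es *; apply: base => //; by rewrite eq_sym.
have [eg|ge] := eqVneq g e.
  by rewrite eg in es *; apply/esym/base => //; rewrite setUC.
have [CF Fe sFB sF] := hF f fK fe; have [CG Ge sGB sG] := hF g gK ge.
have onlye v : v \in B -> v \in K -> v = e.
  by move=> vB vK; apply/set1P; rewrite -eB inE vB.
have notin h W : supp W :&: K = [set e; h] -> forall v, v \in K -> v != e ->
  v != h -> W v = None.
  move=> sW v vK ve vh; apply: supp_notin; apply/negP => vW.
  have : v \in [set e; h] by rewrite -sW inE vW.
  by rewrite !inE (negPf ve) (negPf vh).
have mod : modular_pair N (supp (F f)) (supp (F g)).
  apply: (basis_modular Nac Nel (mbasis_indep bB) (y := f) (z := g));
    try exact: supp_circuit.
  - apply/eqP => eq; have /suppP := Ff f fK fe; rewrite eq => /suppP; apply.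
    exact: (notin g).
  - apply: subset_trans sFB _; exact/setUS/subsetUr.
  - apply: subset_trans sGB _; exact: subsetUr.
have [||Z [CZ Ze hZ]] := modular_elim CF CG mod (e := e); rewrite ?Fe ?Ge //.
(* [F g] vanishes at [f], so elimination keeps the value of [F f] there. *)
have Zf : Z f = F f f.
  have := hZ f; rewrite (notin g (F g) sG f) // => /gaddP; case=> -[] //.
    by move=> h; case: (Ff f fK fe).
  by move=> <- /gle0 ->.
have Zg : Z g = F g g.
  have gf : g != f by rewrite eq_sym.
  have := hZ g; rewrite (notin f (F f) sF g) // => /gaddP; case=> -[] //.
    by move=> h; case: (Ff g gK ge).
  by move=> <- /gle0 ->.
have sZ : supp Z :&: K = [set f; g].
  apply/setP => v; rewrite in_setI in_set2; apply/andP/orP => [[vZ vK]|].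
    have ve : v != e by apply: contraTneq vZ => ->; apply/suppP; rewrite Ze.
    case: (supp_gadd (hZ v) vZ) => vF.
      have : v \in [set e; f] by rewrite -sF inE vF.
      by rewrite in_set2 (negPf ve); left.
    have : v \in [set e; g] by rewrite -sG inE vF.
    by rewrite in_set2 (negPf ve); right.
  by case=> /eqP->; split=> //; apply/suppP; rewrite ?Zf ?Zg; exact: Ff.
have Xf : X f <> None.
  by apply/suppP; have /setIP[] : f \in supp X :&: K by rewrite es !inE eqxx.
have a0 : gmul (X f) (ginv (Z f)) <> None.
  by apply/gmul_neq0; rewrite ginv_neq0 Zf; split=> //; exact: Ff.
rewrite /prodv; have <- : gmul (gmul (X f) (ginv (Z f))) (Z g) = X g.
  have := cocircuit_ratio KN fg (circuit_lscale a0 CZ) CX.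
  rewrite supp_lscale // !ffunE => /(_ sZ es).
  rewrite /= gmulKV; last by rewrite Zf; exact: Ff.
  exact.
rewrite !Yf // -Zf -Zg -gmulA gmulVr ?gmul1r //; apply/eqP; rewrite Zg; exact: Ff.
Qed.

Lemma circuit_dual_orth X Y : C X -> dual_vector Y -> orthogonal X Y.
Proof.
move=> CX dY; move: {2}(#|supp X :&: supp Y|).+1 (ltnSn #|supp X :&: supp Y|) => n.
elim: n X CX => // n IHn X CX; rewrite ltnS => le_n; apply/orthP => e ne.
have KN := dY.1; have /prodv_neq0[eX eY] := ne.
have [f fe /andP[fX fY]] := circuit_cocircuit Nac Nel (supp_circuit CX) KN eX eY.
have [card2|card3] := leqP #|supp X :&: supp Y| 2.
  exists f => //; rewrite (dY.2 X e f CX) ?glexx // 1?eq_sym //.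
  apply/esym/eqP; rewrite eqEcard; apply/andP; split.
    by rewrite subUset !sub1set !in_setI eX eY fX fY.
  by rewrite cards2 eq_sym fe.
apply: contrapT => no.
have strict h : h != e -> ~ gle (prodv X Y e) (prodv X Y h) by move=> he le;
  apply: no; exists h.
have [T TN [mod eT prT]] := modular_extension Nac Nel (supp_circuit CX)
  KN eX eY card3.
have [W CW sW] := circuit_supp TN.
have eTK : e \in T :&: supp Y by rewrite inE eT.
have TKX h : h \in T -> h \in supp Y -> h \in supp X.
  by move=> hT hY; have /setIP[] := subsetP (proper_sub prT)
    h (introT setIP (conj hT hY)).
(* [W] is scaled to lie below [X] on [supp Y] and to touch it at [g], the element to be
   eliminated. *)
have [||a [g [a0 /setIP[gT gY] eg le]]] := @tight_scaling _ _ _ _ W X e eTK.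
- by rewrite sW subsetIl.
- by apply/subsetP => h /setIP[]; exact: TKX.
pose W' : vec := lscale (a : GammaMax Gamma) W.
have CW' : C W' by exact: circuit_lscale.
have sW' : supp W' = T by rewrite /W' supp_lscale.
have W'E h : W' h = gmul a (W h) by rewrite /W' ffunE.
have leW h : h \in supp Y -> gle (W' h) (X h).
  move=> hY; have [hT|hT] := boolP (h \in T).
    by rewrite W'E; apply: le; rewrite inE hT.
  by rewrite (supp_notin (X := W')) // sW'.
have smaller Z : C Z -> supp Z :&: supp Y \proper supp X :&: supp Y ->
  orthogonal Z Y.
  by move=> CZ pr; apply: IHn => //; exact: leq_trans (proper_card pr) le_n.
(* Otherwise induction applied to [W'] would already give a second product dominating the one at
   [e]. *)
have ne_e : W' e <> X e.
  have prW : supp W' :&: supp Y \proper supp X :&: supp Y by rewrite sW'.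
  move=> ee; have /orthP/(_ e) := smaller W' CW' prW.
  rewrite {1 2}/prodv ee => /(_ ne)[h he leh]; apply: (strict h he).
  have /prodv_neq0[_ hY] := gle_neq0 leh ne.
  apply: gle_trans leh _.
  exact/gle_mul2r/leW.
have eqg : X g = W' g by rewrite W'E eg.
have gX : g \in supp X by exact: TKX.
have [|||Z [CZ Zg hZ]] := @modular_elim X W' g CX CW'.
- by rewrite sW'.
- exact: eqg.
- exact/suppP.
(* At [e] the summands differ and [X e] is the larger, so it survives. *)
have Ze : Z e = X e.
  case/gaddP: (hZ e) => -[] // h1 h2; first by case: ne_e.
  by case: ne_e; apply: gle_anti => //; exact: leW.
have prZ : supp Z :&: supp Y \proper supp X :&: supp Y.
  apply/properP; split; last first.
    by exists g; rewrite in_setI ?gX // negb_and; apply/orP; left; apply/suppP;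
      rewrite Zg.
  apply/subsetP => h /setIP[hZ' hY]; rewrite in_setI hY andbT.
  by case: (supp_gadd (hZ h) hZ') => //; rewrite sW' => hT; exact: TKX.
have /orthP/(_ e) := smaller Z CZ prZ; rewrite {1 2}/prodv Ze => /(_ ne)[h he leh].
have /prodv_neq0[_ hY] := gle_neq0 leh ne.
apply: (strict h he); apply: gle_trans leh _.
by apply: gle_mul2r; apply: gadd_le (hZ h) (glexx _) (leW h hY).
Qed.

(** * The dual matroid *)

Lemma supports_dual : supports dual_vector = mcocircuits N.
Proof.
apply/setP => K; rewrite inE; apply/asboolP/idP; first by case=> Z [h _] <-.
by case/dual_vector_exists => Z dZ sZ; exists Z.
Qed.

(** For elimination, a basis [B] is taken that meets the supports of [Y] and [Y'] in [f] and [g]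
    alone. The result [Y2] is the fundamental cocircuit of [f] after [e] replaces [g], and
    orthogonality to fundamental circuits of [B] yields the required sums. *)
Lemma dual_circuit_axioms :
  circuit_axioms (@rscale (GammaMax Gamma) E) dual_vector.
Proof.
split.
- case=> [/cocircuit_neq0[e /suppP]]; by rewrite ffunE.
- by move=> a Y /eqP a0; exact: dual_vector_scale.
- move=> X Y dX dY sXY; have es := cocircuit_antichain dX.1 dY.1 sXY.
  have [e eX] := cocircuit_neq0 dX.1; have /suppP Xe := eX.
  have /suppP Ye : e \in supp Y by rewrite -es.
  have a0 : gmul (ginv (X e)) (Y e) <> None by apply/gmul_neq0; rewrite ginv_neq0.
  exists (gmul (ginv (X e)) (Y e)); first exact/eqP.
  apply/ffunP => f; rewrite ffunE.
  have [->|fe] := eqVneq f e; first exact/esym/gmulVK.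
  have [fX|fX] := boolP (f \in supp X); last first.
    by rewrite (supp_notin fX) [LHS]supp_notin -?es.
  have [B bB eB] := cocircuit_basis dX.1 eX.
  (* A circuit meeting the common support in [e] and [f] only imposes the same ratio on both
     vectors. *)
  have [S SN [fS eS _ mS]] := fund_circuit_co Nac Nel bB dX.1 eB fX fe.
  have [W CW sW] := circuit_supp SN.
  have ef : e != f by rewrite eq_sym.
  have /suppP Wf : f \in supp W by rewrite sW.
  have := dX.2 W e f CW ef; rewrite sW mS => /(_ erefl) h1.
  have := dY.2 W e f CW ef; rewrite sW -es mS => /(_ erefl) h2.
  apply: (gmul_injl Wf); rewrite -[LHS]h2 [RHS]gmulA -[gmul (W f) (X f)]h1.
  by rewrite /prodv -gmulA gmulVK.
move=> Y Y' e dY dY' mod ee ne.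
have ne' : Y e <> None by apply/eqP.
rewrite supports_dual in mod.
have eK : e \in supp Y by apply/suppP.
have eK' : e \in supp Y' by apply/suppP; rewrite -[Y' e]ee.
have [B [f [g [bB eB eB' fK' gK]]]] := modular_cocircuits Nac Nel dY.1 dY'.1 mod.
have inB v : v \in B -> v \in supp Y -> v = f by move=> h1 h2; apply/set1P;
  rewrite -eB inE h1.
have inB' v : v \in B -> v \in supp Y' -> v = g by move=> h1 h2; apply/set1P;
  rewrite -eB' inE h1.
have /setIP[fB fK] : f \in B :&: supp Y by rewrite eB inE.
have /setIP[gB gK'] : g \in B :&: supp Y' by rewrite eB' inE.
have fg : f != g by apply: contraNneq fK' => ->.
have ef : e != f by apply: contraNneq fK' => <-.
have eg : e != g by apply: contraNneq gK => <-.
have eB0 : e \notin B by apply: contraNN ef => h; apply/eqP/inB.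
have [S SN [eS fS sS mS]] := fund_circuit_co Nac Nel bB dY.1 eB eK ef.
have [S' S'N [_ gS' sS' mS']] := fund_circuit_co Nac Nel bB dY'.1 eB' eK' eg.
(* The two fundamental circuits of [e] coincide, so [S] passes through [g] as well and [g] can be
   exchanged for [e]. *)
have eSS := fund_circuit_uniq Nel (mbasis_indep bB) S'N SN sS' sS.
rewrite eSS in gS' mS'.
have bB2 := basis_swap Nac Nel bB eB0 SN sS gS' gB.
have fB2 : f \in e |: (B :\ g) by rewrite !inE fg fB orbT.
have [K2 K2N eB2] := fund_cocircuit bB2 fB2.
have inB2 v : v \in e |: (B :\ g) -> v \in K2 -> v = f.
  by move=> h1 h2; apply/set1P; rewrite -eB2 in_setI h1.
have /setIP[_ fK2] : f \in (e |: (B :\ g)) :&: K2 by rewrite eB2 inE.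
have [Y0 dY0 sY0] := dual_vector_exists K2N.
have /suppP Y0f : f \in supp Y0 by rewrite sY0.
have /suppP Yf := fK.
have a0 : gmul (ginv (Y0 f)) (Y f) <> None by apply/gmul_neq0; rewrite ginv_neq0.
pose Y2 : vec := rscale (gmul (ginv (Y0 f)) (Y f) : GammaMax Gamma) Y0.
have dY2 : dual_vector Y2 by exact: dual_vector_scale.
have sY2 : supp Y2 = K2 by rewrite /Y2 supp_rscale.
have Y2f : Y2 f = Y f by rewrite /Y2 ffunE; exact: gmulVK.
have inBK2 v : v \in B -> v \in supp Y2 -> v = f \/ v = g.
  rewrite sY2 => vB vK; have [->|vg] := eqVneq v g; first by right.
  by left; apply: inB2 => //; rewrite !inE vg vB orbT.
have Y2e : Y2 e = None.
  apply: supp_notin; rewrite sY2; apply: contraNN ef => h; apply/eqP/inB2 => //.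
  by rewrite !inE eqxx.
(* On the circuit [X] with support [S], the product with [Y2] at [g] equals that at [f], which is
   the product with [Y] at [f] and hence at [e]; there [Y] and [Y'] agree, and [Y'] leads back to
   [g]. *)
have Y2g : Y2 g = Y' g.
  have [X CX sX] := circuit_supp SN.
  have /suppP Xg : g \in supp X by rewrite sX.
  have ne_g : g != f by rewrite eq_sym.
  have h1 : prodv X Y f = prodv X Y e.
    by apply: dY.2; rewrite // ?sX // eq_sym.
  have h2 : prodv X Y' g = prodv X Y' e.
    by apply: dY'.2; rewrite // ?sX // eq_sym.
  have h3 : prodv X Y2 f = prodv X Y2 g.
    apply: orth_two => //; first exact: circuit_dual_orth.
    rewrite sX => v /(subsetP sS); rewrite in_setU1 => /orP[/eqP->|vB];
      last exact: inBK2.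
    by move=> /suppP; rewrite Y2e.
  apply: (gmul_injl Xg); rewrite -[LHS]h3 -[RHS]/(prodv X Y' g) h2 /prodv Y2f.
  by rewrite -[LHS]/(prodv X Y f) h1 /prodv; congr gmul.
exists Y2; split=> // h.
have [hB|hB] := boolP (h \in B).
  have [->|hf] := eqVneq h f.
    rewrite Y2f [Y' f]supp_notin //; apply/gaddP; constructor 2; by split.
  have [->|hg] := eqVneq h g.
    by rewrite Y2g [Y g]supp_notin //; apply/gaddP; constructor 3; split.
  rewrite !supp_notin; first by apply/gaddP; constructor 1.
  - by apply/negP => /(inBK2 h hB)[]; apply/eqP.
  - by apply/negP => /(inB' h hB); apply/eqP.
  - by apply/negP => /(inB h hB); apply/eqP.
(* Off [B], the fundamental circuit of [h] meets [supp Y2] at most in [f], [g] and [h]. Its products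
   at [f] and [g] move to [h] through [Y] and [Y'], and [W h] cancels. *)
have [T TN /andP[hT sT]] := fund_circuit bB hB.
have [W CW sW] := circuit_supp TN.
have /suppP Wh : h \in supp W by rewrite sW.
have fh : f != h by apply: contraNneq hB => <-.
have gh : g != h by apply: contraNneq hB => <-.
have inW v : v \in supp W -> v = h \/ v \in B.
  by rewrite sW => /(subsetP sT); rewrite in_setU1 => /orP[/eqP|]; [left|right].
have h1 : prodv W Y f = prodv W Y h.
  apply: orth_two => //; first exact: circuit_dual_orth.
  by move=> v /inW[->|vB vY]; [right|left; exact: inB].
have h2 : prodv W Y' g = prodv W Y' h.
  apply: orth_two => //; first exact: circuit_dual_orth.
  by move=> v /inW[->|vB vY]; [right|left; exact: inB'].
have : gadd (prodv W Y2 f) (prodv W Y2 g) (prodv W Y2 h).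
  apply: orth_three; first exact: circuit_dual_orth.
  move=> v /inW[->|vB /(inBK2 v vB)[]->];
    by [constructor 3|constructor 1|constructor 2].
have -> : prodv W Y2 f = prodv W Y h by rewrite -h1 /prodv Y2f.
have -> : prodv W Y2 g = prodv W Y' h by rewrite -h2 /prodv Y2g.
exact: gadd_cancell.
Qed.

(** The circuits of any dual satisfy the two-element condition, and the vectors given by
    [dual_vector] themselves form a dual; this removes the quantification over duals. *)
Lemma cocircuitsE Y : cocircuits M Y <-> dual_vector Y.
Proof.
split=> [[M' [sM' oM'] MY]|dY].
  have sY : supp Y \in mcocircuits N.
    by rewrite -sM' inE; apply/asboolP; exists Y.
  split=> // X f g CX fg es; apply: orth_two (fg) _.
    by apply: oM' => //; rewrite es cards2 fg.
  move=> h hX hY; have : h \in [set f; g] by rewrite -es inE hX.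
  by rewrite in_set2 => /orP[]/eqP; [left|right].
exists (RightMatroid dual_circuit_axioms) => //; split=> /=.
  exact: supports_dual.
by move=> X Z CX dZ _; exact: circuit_dual_orth.
Qed.

(** * Tight bases and the decomposition of vectors *)

(** Induction on [A], removing [x]. If [B] does not span [x], then [x] joins [B]. Otherwise the
    circuit through [x] is scaled to lie below [V] and touch it at some [g]; for [g] other than [x],
    the element [x] replaces [g]. *)
Lemma tight_basis V A : A \subset supp V ->
  exists B, [/\ mindep N B, B \subset A & forall e, e \in A -> e \notin B ->
    exists X, [/\ C X, supp X \subset e |: B, X e = V e & forall f, gle (X f)
      (V f)]].
Proof.
move: {2}(#|A|).+1 (ltnSn #|A|) => n.
elim: n A => // n IHn A; rewrite ltnS => le_n sAV.
have [->|[x xA]] := set_0Vmem A.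
  have [B0 /mbasis_indep i0] := mbasis_exists.
  exists set0; split=> //; first by apply: mindep_sub i0; exact: sub0set.
  by move=> e; rewrite inE.
have [||B [iB sB hB]] := IHn (A :\ x).
- by apply: leq_trans le_n; rewrite [leqRHS](cardsD1 x) xA.
- exact: subset_trans (subD1set _ _) sAV.
have xB : x \notin B by apply/negP => /(subsetP sB); rewrite !inE eqxx.
have sBA : B \subset A by exact: subset_trans sB (subD1set _ _).
have [sp|nsp] := pselect (spans N B x); last first.
  exists (x |: B); split; first exact: mindepU1.
    by rewrite subUset sub1set xA.
  move=> e eA; rewrite in_setU1 negb_or => /andP[ex eB].
  have [|X [CX sX Xe leX]] := hB e _ eB; first by rewrite in_setD1 ex.
  by exists X; split=> //; apply: subset_trans sX _; rewrite setUS // subsetUr.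
case: sp => [|[S SN /andP[xS sS]]]; first by rewrite (negPf xB).
have [W CW sW] := circuit_supp SN.
have SA : S \subset A by apply: subset_trans sS _; rewrite subUset sub1set xA.
have [||a [g [a0 gS eg le]]] := @tight_scaling _ _ _ S W V x xS.
- by rewrite sW.
- exact: subset_trans SA sAV.
pose X : vec := lscale (a : GammaMax Gamma) W.
have CX : C X by exact: circuit_lscale.
have sX : supp X = S by rewrite /X supp_lscale.
have Xg : X g = V g by rewrite /X ffunE.
have leX f : gle (X f) (V f).
  have [fS|fS] := boolP (f \in S); first by rewrite /X ffunE; exact: le.
  by rewrite (supp_notin (X := X)) // sX.
have [gx|gx] := eqVneq g x.
  exists B; split=> // e eA eB; have [->|ex] := eqVneq e x; last first.
    by apply: hB => //; rewrite in_setD1 ex.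
  by exists X; rewrite sX -{2}gx; split=> //; rewrite -gx.
have gB : g \in B by have := subsetP sS g gS; rewrite in_setU1 (negPf gx).
exists (x |: (B :\ g)); split; first exact: indep_swap SN sS gS gB.
  by rewrite subUset sub1set xA (subset_trans (subD1set _ _)).
move=> e eA; rewrite in_setU1 negb_or in_setD1 negb_and negbK => /andP[ex].
have [-> _|eg'] := eqVneq e g.
  exists X; split=> //; rewrite sX; apply: subset_trans sS _; apply/subsetP => v.
  by rewrite !inE; case: (v == g) => //=.
move=> /= eB; have [|X' [CX' sX' X'e leX']] := hB e _ eB; first
  by rewrite in_setD1 ex.
have Ve : V e <> None by apply/suppP/(subsetP sAV).
(* Only old circuits through [g] leave the new basis; they are corrected by eliminating [g] against
   a multiple of [X]. *)
have [X'g|X'g] := pselect (X' g = None).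
  exists X'; split=> //; apply/subsetP => v vX'.
  have vg : v != g by apply: contraTneq vX' => ->; apply/suppP; rewrite X'g.
  by have := subsetP sX' v vX'; rewrite !inE vg => /orP[->//|->]; rewrite !orbT.
have Xg0 : X g <> None by apply/suppP; rewrite sX.
have b0 : gmul (X' g) (ginv (X g)) <> None by apply/gmul_neq0; rewrite ginv_neq0.
pose X1 : vec := lscale (gmul (X' g) (ginv (X g)) : GammaMax Gamma) X.
have CX1 : C X1 by exact: circuit_lscale.
have sX1 : supp X1 = S by rewrite /X1 supp_lscale.
have X1g : X1 g = X' g by rewrite /X1 ffunE; exact: gmulKV.
have leX1 f : gle (X1 f) (V f).
  apply: gle_trans (leX f); rewrite /X1 ffunE.
  (* The scalar is at most one because [X' g] lies below [V g], which equals [X g]. *)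
  have b1 : gle (gmul (X' g) (ginv (X g))) (Some 1%g).
    rewrite -(gmulVr (introN eqP Xg0)); apply: gle_mul2r.
    by rewrite Xg.
  by have := gle_mul2r (X f) b1; rewrite gmul1l.
have eS : e \notin S.
  by apply/negP => /(subsetP sS); rewrite in_setU1 (negPf ex) (negPf eB).
have mod : modular_pair N (supp X') (supp X1).
  apply: (basis_modular Nac Nel iB (y := e) (z := x)); try exact: supp_circuit.
  - apply: contraNneq eS => es; rewrite -sX1 -es; apply/suppP; by rewrite X'e.
  - by apply: subset_trans sX' _; rewrite setUS // subsetUr.
  - by rewrite sX1; apply: subset_trans sS _; exact: subsetUr.
have [Z [CZ Zg hZ]] := modular_elim CX' CX1 mod (esym X1g) X'g.
exists Z; split=> //.
- apply/subsetP => v vZ.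
  have vg : v != g by apply: contraTneq vZ => ->; apply/suppP; rewrite Zg.
  case: (supp_gadd (hZ v) vZ) => [/(subsetP sX')|].
    by rewrite !inE vg => /orP[->//|->]; rewrite !orbT.
  by rewrite sX1 => /(subsetP sS); rewrite !inE vg => /orP[->//|->]; rewrite !orbT.
(* [S] misses [e], so elimination leaves the value [V e] intact. *)
- have := hZ e; rewrite [X1 e]supp_notin ?sX1 // X'e => /gaddP; case=> -[] //.
  by move=> <- /gle0.
- by move=> f; exact: gadd_le (hZ f) (leX' f) (leX1 f).
Qed.

(** Fundamental cocircuits require a basis of the whole matroid, hence [Bh]. Orthogonality of [V] to
    the one at [b] gives a dominating product at some [f] outside [B], and orthogonality of the
    circuit [X f] carries this bound back to [b]. *)
Lemma vector_tight V B Bh (X : E -> vec) (b : E) : (forall Y, dual_vector Y ->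
  orthogonal V Y) ->
  mbasis N Bh -> B \subset Bh -> B \subset supp V ->
  (forall e, e \in supp V -> e \notin B ->
    [/\ C (X e), supp (X e) \subset e |: B, X e e = V e & forall f, gle (X e f)
      (V f)]) ->
  b \in B -> exists2 e, e \in supp V :\: B & X e b = V b.
Proof.
move=> hV bBh sBh sBV hX bB.
have [K KN eK] := fund_cocircuit bBh (subsetP sBh b bB).
have [Y dY sY] := dual_vector_exists KN.
have inB v : v \in B -> v \in K -> v = b.
  by move=> vB vK; apply/set1P; rewrite -eK inE (subsetP sBh).
have /setIP[_ bK] : b \in Bh :&: K by rewrite eK inE.
have nb : prodv V Y b <> None by apply/prodv_neq0; rewrite sY (subsetP sBV).
have /orthP/(_ b nb)[f fb le] := hV Y dY.
have /prodv_neq0[fV] := gle_neq0 le nb; rewrite sY => fK.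
have fB : f \notin B by apply: contraNN fb => /inB h; apply/eqP/h.
have [CX sX Xf leX] := hX f fV fB.
exists f; first by rewrite inE fB.
apply: gle_anti => //; have /suppP Yb : b \in supp Y by rewrite sY.
apply: (gle_cancelr Yb); apply: gle_trans le _.
have -> : prodv V Y f = prodv (X f) Y f by rewrite /prodv Xf.
rewrite (orth_two (circuit_dual_orth CX dY) fb) ?glexx // => h.
move=> /(subsetP sX); rewrite in_setU1 sY => /orP[/eqP->|hB hK]; first by left.
by right; exact: inB.
Qed.

End LeftMatroid.

(** * Vectors as compositions of circuits *)

Local Open Scope classical_set_scope.

Theorem theorem22 (d : Order.disp_t) (Gamma : orderedGroupType d)
    (E : finType) (M : leftMatroid (GammaMax Gamma) E) :
  vectors M =
  [set V | exists (k : nat) (X : 'I_k -> {ffun E -> GammaMax Gamma}),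
     [/\ (k <= corank M)%N,
         forall i, circuits M (X i)
       & V = \big[@vcomp d Gamma E/vzero (GammaMax Gamma) E]_(i < k) X i]].
Proof.
apply/seteqP; split=> [V hV|_ [k [X [_ CX ->]]] Y /cocircuitsE dY]; last first.
  by elim/big_ind: _ => [|U W|i _];
    [exact: orth0 | exact: orth_vcomp | exact: circuit_dual_orth].
have {}hV Y : dual_vector M Y -> orthogonal V Y by move=> /cocircuitsE /hV.
have [B [iB sB hB]] := tight_basis M (subxx (supp V)).
have /boolp.choice[X hX] : forall e, exists X, e \in supp V -> e \notin B ->
    [/\ circuits M X, supp X \subset (e |: B)%SET, X e = V e &
        forall f, gle (X f) (V f)].
  (* For [e] outside [supp V] or inside [B], [V] is a mere default value. *)
  move=> e; have [eV|_] := boolP (e \in supp V); last by exists V.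
  have [_|eB] := boolP (e \in B); first by exists V.
  by have [X hX] := hB e eV eB; exists X.
have [B0 bB0] := mbasis_exists M.
have [Bh [bBh sBh _]] := basis_extend (@supp_antichain _ _ _ M)
  (@supp_elim _ _ _ M) iB bB0.
pose R := (supp V :\: B)%SET.
have inR (i : 'I_#|R|) : enum_val i \in supp V /\ enum_val i \notin B.
  by have := enum_valP i; rewrite in_setD => /andP[].
exists #|R|, (fun i => X (enum_val i)); split.
(* [R] is coindependent, being disjoint from [Bh]: a common element would put its fundamental
   circuit inside [Bh]. *)
- apply: (@leq_bigmax_cond _ (mcoindep _) (fun A : {set E} => #|A|) R).
  apply/existsP; exists Bh; rewrite bBh; apply/subsetP => f.
  rewrite in_setD in_setC => /andP[fB fV]; apply/negP => fBh.
  have [CX sX _ _] := hX f fV fB.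
  apply: (mindepP _ _ (mbasis_indep bBh) _ (supp_circuit CX)).
  by apply: fintype.subset_trans sX _; rewrite finset.subUset sub1set fBh.
- by move=> i; have [iV iB'] := inR i; have [] := hX _ iV iB'.
apply/ffunP => e; apply: gle_anti; last first.
  apply: (@big_vcomp_le d Gamma E) => i f.
  by have [iV iB'] := inR i; have [_ _ _ ->] := hX _ iV iB'.
have [eV|eV] := boolP (e \in supp V); last by rewrite (supp_notin eV).
(* Elements of [B] are attained by tightness, the others by their own circuits. *)
have [f fR <-] : exists2 f, f \in R & X f e = V e.
  have [eB|eB] := boolP (e \in B); first exact: vector_tight hV bBh sBh sB hX eB.
  by have [_ _ Xe _] := hX e eV eB; exists e; rewrite // in_setD eB.
rewrite -{1}(enum_rankK_in fR fR).
exact: (@big_vcomp_ub _ _ _ _ _ (fun i : 'I_#|R| => X (enum_val i)))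
  (mem_index_enum _).
Qed.
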